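(* Let $f:M^n\to S^{2n-2}$ be a conformally flat immersion with flat normal bundle, and let $F=-e^{u}(f+t_0)$ be a flat lift of $f$. Then: 1. The curvature directions on $M^n$ induced by $F$ and by $f$ are identical. 2. If $v_i,\ v_i^S,\ v_i^{\mathbb{R}}$ are corresponding curvature normals of $F$ and of $f$ (the latter regarded as a map into $S^{2n-2}$ and into $\mathbb{R}^{2n-1}=t_0^\perp$ respectively), and $\mathbf{e}_i,\tilde{\mathbf{e}}_i$ are the corresponding (unit) curvature directions of $F$ and $f$, then $$\tilde{\mathbf{e}}_i=-\mathbf{e}_i+e^{-u}(\mathbf{e}_i,t_0)F,\qquad v_i^S=-e^u\pi_{N_f}v_i=v_i^{\mathbb{R}}+f .$$ 3. All curvature normals of $F$ are non-zero. 4. $F$ has non-degenerate normal bundle if and only if $f$ has uniform multiplicity one.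
   Context: $\mathbb{R}^{2n-1,1}$ is $\mathbb{R}^{2n}$ with the Lorentzian bilinear form $(x,y)=x^T\operatorname{diag}(1,\dots,1,-1)\,y$, and $\mathcal{L}^{2n-1,1}=\{x:(x,x)=0\}$ is its light-cone. Fix $t_0$ with $(t_0,t_0)=-1$; $t_0^\perp$ is Euclidean $\mathbb{R}^{2n-1}$ and $S^{2n-2}$ is its unit sphere. An immersion $f:M^n\to S^{2n-2}$ is conformally flat if $e^{2u}\mathrm{I}_f$ is flat for some smooth $u:M\to\mathbb{R}$; then $F=-e^u(f+t_0):M\to\mathcal{L}^{2n-1,1}$ is an immersion with flat induced metric $\mathrm{I}_F=e^{2u}\mathrm{I}_f$, called a flat lift of $f$ (so $(F,t_0)=e^u$), and it also has flat normal bundle. $N_f$ is the normal bundle of $f$ in $TS^{2n-2}$, viewed as a subbundle of $M\times\mathbb{R}^{2n-1,1}$, and $\pi_{N_f}$ is orthogonal projection of $M\times\mathbb{R}^{2n-1,1}$ onto it. $N_F$ is the orthogonal complement of the tangent bundle of $F$ in $M\times\mathbb{R}^{2n-1,1}$. Viewed as an immersion in $\mathbb{R}^{2n-1}$, $f$ has normal bundle $\langle f\rangle\oplus N_f$, which is also flat. For an immersion with flat normal bundle, the shape operator $A_v$ of a normal vector $v$ is the tangential part of $-\nabla v$; all shape operators at a point commute and their common eigenspaces are the curvature distributions, whose directions are the curvature directions. The curvature normal of an eigenspace $E_i$ is the normal vector $v_i$ with $A_v|_{E_i}=(v,v_i)\operatorname{Id}$ for all normal $v$. The vectors $\mathbf{e}_i$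 (resp. $\tilde{\mathbf{e}}_i$) are orthonormal tangent frames of $F$ (resp. $f$) consisting of curvature directions. $N_F$ is non-degenerate if at each point the space of shape operators has dimension equal to the codimension $n$. An immersion has uniform multiplicity one if it has flat normal bundle and distinct curvature normals (equivalently, every curvature distribution has rank one).
   Formalization: The formal theorem assumes n ≥ 3; for n = 2 the claim is false: f is then open in S^2 with all directions curvature directions and a single curvature normal, while a flat lift F can have distinct curvature normals, so parts 1 and 4 fail. *)

(* Defs.v *)
From mathcomp Require Import all_boot all_order all_algebra.
From mathcomp Require Import all_classical all_reals all_analysis.
Set Implicit Arguments.
Unset Strict Implicit.
Unset Printing Implicit Defensive.
Import Order.TTheory GRing.Theory Num.Theory.
Import numFieldNormedType.Exports.
Local Open Scope classical_set_scope.
Local Open Scope ring_scope.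

Section Smooth.
Variables (R : realType) (V W : normedModType R).

(* C^k on an open set U; the values of g outside U are irrelevant. *)
Fixpoint Ck_on (k : nat) (U : set V) (g : V -> W) : Prop :=
  match k with
  | 0 => forall x, U x -> {for x, continuous g}
  | k'.+1 => (forall x, U x -> differentiable g x) /\
             (forall v, Ck_on k' U (fun x => 'D_v g x))
  end.

Definition smooth_on (U : set V) (g : V -> W) : Prop :=
  forall k, Ck_on k U g.

End Smooth.

Section Manifold.
Variables (R : realType) (n : nat).

Record chart (T : topologicalType) := Chart {
  cdom : set T;
  cmap : T -> 'rV[R]_n;
  cinv : 'rV[R]_n -> T }.

Definition ccod (T : topologicalType) (c : chart T) : set 'rV[R]_n :=
  cmap c @` cdom c.

Definition is_chart (T : topologicalType) (c : chart T) : Prop :=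
  [/\ open (cdom c), open (ccod c),
      (forall p, cdom c p -> cinv c (cmap c p) = p),
      {within cdom c, continuous (cmap c)} &
      {within ccod c, continuous (cinv c)}].

Definition smooth_transition (T : topologicalType) (c d : chart T) : Prop :=
  smooth_on (cmap c @` (cdom c `&` cdom d)) (cmap d \o cinv c).

Record manifold := Manifold {
  mcarrier :> topologicalType;
  atlas : set (chart mcarrier);
  manifold_hausdorff : hausdorff_space mcarrier;
  manifold_second_countable : @second_countable mcarrier;
  atlas_charts : forall c, atlas c -> is_chart c;
  atlas_cover : forall p, exists2 c, atlas c & cdom c p;
  atlas_smooth : forall c d, atlas c -> atlas d -> smooth_transition c d }.

Definition smooth_map (M : manifold) (W : normedModType R) (g : M -> W) :=
  forall c, atlas c -> smooth_on (ccod c) (g \o cinv c).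

End Manifold.

Section RiemannCurvature.
Variables (R : realType) (n : nat).
Implicit Type g : 'rV[R]_n -> 'M[R]_n.

Definition pderiv (W : normedModType R) (h : 'rV[R]_n -> W) (i : 'I_n) :
  'rV[R]_n -> W := fun x => 'D_(delta_mx 0 i) h x.

(* Gamma^k_{ij} *)
Definition christoffel g (k i j : 'I_n) (x : 'rV[R]_n) : R :=
  2^-1 * \sum_(l < n) (invmx (g x)) k l *
    (pderiv (fun y => g y j l : R^o) i x
     + pderiv (fun y => g y i l : R^o) j x
     - pderiv (fun y => g y i j : R^o) l x).

(* R(d_i, d_j) d_k = \sum_l R^l_{kij} d_l *)
Definition riemann g (l k i j : 'I_n) (x : 'rV[R]_n) : R :=
  pderiv (christoffel g l j k : _ -> R^o) i x
  - pderiv (christoffel g l i k : _ -> R^o) j x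
  + \sum_(m < n) (christoffel g l i m x * christoffel g m j k x
                  - christoffel g l j m x * christoffel g m i k x).

Definition flat_metric_on (U : set 'rV[R]_n) g : Prop :=
  forall x, U x -> forall l k i j, riemann g l k i j x = 0.

End RiemannCurvature.

Section Lorentz.
Variables (R : realType) (N : nat).

Definition lform (x y : 'rV[R]_N) : R :=
  (x *m diag_mx (\row_(i < N) (if i.+1 == N then -1 else 1)) *m y^T) 0 0.

(* Orthogonal projection onto a non-degenerate subspace S. *)
Definition oproj (S : set 'rV[R]_N) (v : 'rV[R]_N) : 'rV[R]_N :=
  xget 0 [set w | S w /\ forall z, S z -> lform (v - w) z = 0].

Definition unit_sphere (t0 : 'rV[R]_N) : set 'rV[R]_N :=
  [set q | lform q t0 = 0 /\ lform q q = 1].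

(* Tangent spaces at q of the ambient spaces in which an immersion may be
   considered: the Lorentz space, the Euclidean hyperplane orthogonal to t0,
   and the unit sphere of the latter. *)
Definition T_lorentz (q : 'rV[R]_N) : set 'rV[R]_N := setT.

Definition T_euclid (t0 q : 'rV[R]_N) : set 'rV[R]_N :=
  [set v | lform v t0 = 0].

Definition T_sphere (t0 q : 'rV[R]_N) : set 'rV[R]_N :=
  [set v | lform v t0 = 0 /\ lform v q = 0].

End Lorentz.

(* Submanifold geometry of a parametrized immersion g : U -> R^{N-1,1}, U open
   in R^n, regarded as an immersion into a submanifold Q whose tangent space at
   q is TQ q.  Tangent vectors at x are given by their coordinates, row vectors
   X standing for sum_i X_i d_i. *)
Section LocalGeometry.
Variables (R : realType) (n N : nat).
Variables (TQ : 'rV[R]_N -> set 'rV[R]_N).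
Variables (U : set 'rV[R]_n) (g : 'rV[R]_n -> 'rV[R]_N).
Local Notation vec := 'rV[R]_N.

Definition induced_metric (x : 'rV[R]_n) : 'M[R]_n :=
  \matrix_(i, j) lform (pderiv g i x) (pderiv g j x).

Definition tangent_space (x : 'rV[R]_n) : set vec :=
  [set w | exists X : 'rV[R]_n, w = 'D_X g x].

Definition normal_subspace (x : 'rV[R]_n) : set vec :=
  [set v | TQ (g x) v /\ forall X : 'rV[R]_n, lform v ('D_X g x) = 0].

Definition normal_field (xi : 'rV[R]_n -> vec) : Prop :=
  smooth_on U xi /\ forall x, U x -> normal_subspace x (xi x).

(* The Levi-Civita connection of Q is the TQ-part of the flat connection of
   R^{N-1,1}, so that the normal connection of g in Q is the normal part of
   the latter; likewise for the tangential part defining the shape operator. *)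
Definition normal_conn (i : 'I_n) (xi : 'rV[R]_n -> vec) : 'rV[R]_n -> vec :=
  fun x => oproj (normal_subspace x) (pderiv xi i x).

(* The coordinate fields commute, so this says that the curvature of the
   normal connection vanishes. *)
Definition flat_normal_conn : Prop :=
  forall xi, normal_field xi -> forall x, U x -> forall i j,
    normal_conn i (normal_conn j xi) x = normal_conn j (normal_conn i xi) x.

(* A is the shape operator A_v at x, acting on coordinate vectors by
   X |-> X *m A; it is computed from a normal field extending v. *)
Definition is_shape_operator (x : 'rV[R]_n) (v : vec) (A : 'M[R]_n) : Prop :=
  exists xi, [/\ normal_field xi, xi x = v &
    forall X : 'rV[R]_n,
      'D_(X *m A) g x = oproj (tangent_space x) (- 'D_X xi x)].

Definition is_curvature_distribution (x : 'rV[R]_n) (E : set 'rV[R]_n) : Prop :=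
  (exists2 X, E X & X != 0) /\
  exists lambda : vec -> R, forall X, E X <->
    (forall v A, is_shape_operator x v A -> X *m A = lambda v *: X).

Definition is_curvature_direction (x : 'rV[R]_n) (X : 'rV[R]_n) : Prop :=
  X != 0 /\ exists2 E, is_curvature_distribution x E & E X.

Definition is_curvature_normal (x : 'rV[R]_n) (E : set 'rV[R]_n) (v : vec) :=
  [/\ is_curvature_distribution x E, normal_subspace x v &
      forall w A, is_shape_operator x w A ->
        forall X, E X -> X *m A = lform w v *: X].

Definition is_shape_space (x : 'rV[R]_n) (S : {vspace 'M[R]_n}) : Prop :=
  forall A, A \in S <-> exists v, is_shape_operator x v A.

End LocalGeometry.

Section Immersions.
Variables (R : realType) (n N : nat) (M : manifold R n).
Implicit Types (g : M -> 'rV[R]_N) (TQ : 'rV[R]_N -> set 'rV[R]_N).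
Implicit Types (c : chart R n M) (p : M).

Definition loc g c : 'rV[R]_n -> 'rV[R]_N := g \o cinv c.

Definition dmap g c p (X : 'rV[R]_n) : 'rV[R]_N := 'D_X (loc g c) (cmap c p).

Definition chart_at c p : Prop := atlas c /\ cdom c p.

Definition immersion g : Prop :=
  smooth_map g /\
  forall c p, chart_at c p -> forall X, dmap g c p X = 0 -> X = 0.

Definition flat_normal_bundle TQ g : Prop :=
  forall c, atlas c -> flat_normal_conn TQ (ccod c) (loc g c).

Definition curvature_direction TQ g c p (X : 'rV[R]_n) : Prop :=
  is_curvature_direction TQ (ccod c) (loc g c) (cmap c p) X.

Definition curvature_normal TQ g c p (E : set 'rV[R]_n) (v : 'rV[R]_N) :=
  is_curvature_normal TQ (ccod c) (loc g c) (cmap c p) E v.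

Definition uniform_multiplicity_one TQ g : Prop :=
  flat_normal_bundle TQ g /\
  forall c p, chart_at c p ->
    exists v : 'I_n -> 'rV[R]_N, injective v /\
      forall i, exists E, curvature_normal TQ g c p E (v i).

(* For immersions of codimension n, as are all immersions in R^{2n-1,1}. *)
Definition nondegenerate_normal_bundle TQ g : Prop :=
  forall c p, chart_at c p ->
    exists S : {vspace 'M[R]_n},
      is_shape_space TQ (ccod c) (loc g c) (cmap c p) S /\ \dim S = n.

(* e^{2u} I_f is flat *)
Definition flattening_factor (f : M -> 'rV[R]_N) (u : M -> R) : Prop :=
  smooth_map (u : M -> R^o) /\
  forall c, atlas c -> flat_metric_on (ccod c)
    (fun x => expR (2 * u (cinv c x)) *: induced_metric (loc f c) x).

Definition conformally_flat (f : M -> 'rV[R]_N) : Prop :=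
  exists u, flattening_factor f u.

Definition flat_lift (t0 : 'rV[R]_N) (f : M -> 'rV[R]_N) (u : M -> R)
    (F : M -> 'rV[R]_N) : Prop :=
  flattening_factor f u /\ forall p, F p = - (expR (u p) *: (f p + t0)).

End Immersions.

(* Main.v *)
From HB Require Import structures.
Require Import Defs.
From mathcomp Require Import all_boot all_order all_algebra.
From mathcomp Require Import all_classical all_reals all_analysis.
From mathcomp Require Import complex.
From mathcomp Require Import ring lra.
Set Implicit Arguments.
Unset Strict Implicit.
Unset Printing Implicit Defensive.
Import Order.TTheory GRing.Theory Num.Theory.
Import numFieldNormedType.Exports.
Local Open Scope classical_set_scope.
Local Open Scope ring_scope.

(** Everything is pointwise and is computed in a chart.  For a spacelike
    immersion [g], the shape operator of a normal vector [v] is the matrix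
    [shape_mx g x v] that represents [(X, Y) |-> (v, D_X D_Y g)] with respect
    to the induced metric (shape_operator_mxP), as soon as [v] extends to a
    smooth normal field, which is obtained by projecting onto the normal spaces.
    Curvature directions are then the common eigenvectors of these matrices
    (curvature_directionP).

    Let [N_f] be the normal space of [f] in the sphere.  It is contained in the
    normal space of [F], and the shape operators of [w] in [N_f] satisfy
    [A^F_w = - e^(-u) A^f_w] (shape_lift_sphere).  Moreover [F] is a null normal
    field of itself, with [A^F_F = - Id].  The second fact shows that every
    curvature normal of [F] has product [-1] with [F], hence is non-zero; the
    first one gives the formulas relating the curvature normals, and shows that
    curvature directions of [F] are curvature directions of [f].

    For the converse let [X] be a curvature direction of [f] and let [Y] be
    orthogonal to [X].  The second fundamental form [II(X, Y)] of [F] is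
    orthogonal to [N_f] and to [F], and so it is a multiple [c F].  As [n > 2],
    there is [Z <> 0] orthogonal to [X] and [Y], for which [II(X, Z)] is also a
    multiple of [F].  Since the metric of [F] is flat, the Gauss equation reads
    [(II(X, Z), II(Z, Y)) = (II(Z, Z), II(X, Y))] (gauss_flat); the left-hand
    side is a multiple of [(Z, Y) = 0] and the right-hand side is [- c (Z, Z)].
    Hence [c = 0], that is, [II(X, Y) = 0] for all [Y] orthogonal to [X]
    (sff_lift_conjugate), and [X] is an eigenvector of all shape operators of
    [F] (sphere_eigenvector_lift).

    Non-degeneracy of [F] implies multiplicity one of [f]: by the Ricci
    equation (ricci) the shape operators of [f] commute, and so they have a
    basis of common eigenvectors.  If two of them, [X] and [Y], had the same
    curvature normal, then [X + Y] would be a curvature direction of [f], hence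
    of [F], and all shape operators of [F] would have equal eigenvalues on [X]
    and [Y]; their space would have dimension less than [n].

    Conversely, let [f] have [n] distinct curvature normals.  The curvature
    directions are orthogonal, and by the Gauss equation so are the curvature
    normals [V_i] of [F].  Two null ones among them would differ by a null
    vector orthogonal to [F], that is, by a multiple of [F], and the
    corresponding curvature normals of [f] would agree.  So at most one [V_i]
    is null.  The shape operator of [V_i] vanishes on the curvature directions
    other than the [i]-th one, where it is multiplication by [(V_i, V_i)];
    together with the identity these operators span all operators that are
    diagonal in the basis of curvature directions. *)

(** * Calculus of smooth functions on an open set *)

Section NearEq.
Variables (R : realType) (V W : normedModType R).
Implicit Types (g h : V -> W) (U : set V).

Lemma near_eq_differentiable g h x :
  (\forall y \near x, g y = h y) -> differentiable h x -> differentiable g x.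
Proof.
move=> gh dh; have gx : g x = h x by apply: nbhs_singleton gh.
have [dc dE] := (diff_locallyP x h).1 dh.
have dgE : g \o shift x = cst (g x) + 'd h x +o_ 0 id.
  apply/eqaddoP => e e0; move/eqaddoP : dE => /(_ e e0) dE.
  have gh0 : \forall y \near (0 : V), g (y + x) = h (y + x).
    by move: gh; rewrite (near_shift 0)/=; apply: filterS => y; rewrite /= subr0.
  near=> y; rewrite !fctE /= gx (near gh0 y) //.
  by near: y; apply: filterS dE => y; rewrite !fctE.
apply/diff_locallyP.
by rewrite (diff_unique dc dgE).
Unshelve. all: by end_near. Qed.

Lemma near_eq_on U g h x : open U -> U x -> (forall y, U y -> g y = h y) ->
  \forall y \near x, g y = h y.
Proof. by move=> oU Ux gh; apply: filterS gh _; apply: open_nbhs_nbhs. Qed.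

Lemma derive_eq_on U g h x v : open U -> U x -> (forall y, U y -> g y = h y) ->
  'D_v g x = 'D_v h x.
Proof. by move=> oU Ux gh; apply/near_eq_derive/(near_eq_on oU Ux gh). Qed.

Lemma smooth_on_differentiable U g x : smooth_on U g -> U x -> differentiable g x.
Proof. by move=> /(_ 1%N) [+ _] Ux; apply. Qed.

Lemma smooth_on_derive U g v : smooth_on U g -> smooth_on U (fun x => 'D_v g x).
Proof. by move=> sg k; have [_] := sg k.+1; apply. Qed.

(** A coinduction principle: a class of functions that are differentiable on
    [U], and whose directional derivatives agree on [U] with functions of the
    class, consists of smooth functions. *)
Lemma smooth_on_coind U (P : (V -> W) -> Prop) : open U ->
  (forall g, P g -> (forall x, U x -> differentiable g x) /\
     forall v, exists2 h, P h & forall x, U x -> 'D_v g x = h x) ->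
  forall g, P g -> smooth_on U g.
Proof.
move=> oU PP g Pg k.
suff: forall g0, (forall x, U x -> g0 x = g x) -> Ck_on k U g0 by apply.
elim: k g Pg => [|k IHk] g Pg g0 g0g /=.
  move=> x Ux; apply/differentiable_continuous.
  exact: near_eq_differentiable (near_eq_on oU Ux g0g) ((PP _ Pg).1 _ Ux).
split=> [x Ux|v].
  exact: near_eq_differentiable (near_eq_on oU Ux g0g) ((PP _ Pg).1 _ Ux).
have [h Ph hE] := (PP _ Pg).2 v.
by apply: IHk Ph _ _ => x Ux; rewrite (derive_eq_on _ oU Ux g0g) hE.
Qed.

Lemma smooth_on_eq U g h : open U -> (forall x, U x -> g x = h x) ->
  smooth_on U h -> smooth_on U g.
Proof.
move=> oU gh sh.
apply: (smooth_on_coind (P := fun g => exists2 h, smooth_on U h & forall x, U x -> g x = h x) oU); last by exists h.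
move=> {gh sh} {}g [{}h sh gh]; split=> [x Ux|v].
  exact: near_eq_differentiable (near_eq_on oU Ux gh) (smooth_on_differentiable sh Ux).
exists (fun x => 'D_v h x); first by exists (fun x => 'D_v h x) => //; apply: smooth_on_derive.
by move=> x Ux; apply: derive_eq_on oU Ux gh.
Qed.

Lemma deriveDl g x v w (a : R) : differentiable g x ->
  'D_(a *: v + w) g x = a *: 'D_v g x + 'D_w g x.
Proof. by move=> dg; rewrite !deriveE // linearP. Qed.

End NearEq.

Section SmoothScalar.
Variables (R : realType) (V : normedModType R) (U : set V).
Hypothesis oU : open U.
Implicit Types g h : V -> R^o.

(** The functions built from smooth ones by the field operations and the
    exponential. *)
Inductive elementary : (V -> R^o) -> Prop :=
| Eb g of smooth_on U g : elementary g
| Ec (a : R) : elementary (fun=> a)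
| Ea g h of elementary g & elementary h : elementary (fun x => g x + h x)
| Em g h of elementary g & elementary h : elementary (fun x => g x * h x)
| Ei g of elementary g & (forall x, U x -> g x != 0) : elementary (fun x => (g x)^-1)
| Ee g of elementary g : elementary (fun x => expR (g x)).

Lemma is_derive_scalarM g h x v : differentiable g x -> differentiable h x ->
  differentiable (fun x => g x * h x : R^o) x /\
  'D_v (fun x => g x * h x : R^o) x = 'D_v g x * h x + g x * 'D_v h x.
Proof.
move=> dg dh; split; first exact: differentiableM.
have /= := @deriveM _ _ g h x v (diff_derivable dg) (diff_derivable dh).
by move=> E; rewrite [LHS]E addrC; congr (_ + _); exact: mulrC.
Qed.

Lemma elementary_smooth g : elementary g -> smooth_on U g.
Proof.
apply: (smooth_on_coind oU) => {}g; elim.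
- move=> {}g sg; split=> [x Ux|v]; first exact: smooth_on_differentiable Ux.
  by exists (fun x => 'D_v g x) => //; apply/Eb/smooth_on_derive.
- move=> a; split=> [x Ux|v]; first exact: differentiable_cst.
  by exists (fun=> 0); [exact: Ec | move=> x Ux; exact: derive_cst].
- move=> {}g h eg [dg Dg] eh [dh Dh]; split=> [x Ux|v].
    by apply: differentiableD; [apply: dg | apply: dh].
  have [g' eg' Dg'] := Dg v; have [h' eh' Dh'] := Dh v.
  exists (fun x => g' x + h' x); first exact: Ea.
  move=> x Ux; rewrite -Dg' // -Dh' //.
  by apply: deriveD; apply: diff_derivable; [apply: dg | apply: dh].
- move=> {}g h eg [dg Dg] eh [dh Dh]; split=> [x Ux|v].
    by apply: differentiableM; [apply: dg | apply: dh].
  have [g' eg' Dg'] := Dg v; have [h' eh' Dh'] := Dh v.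
  exists (fun x => g' x * h x + g x * h' x); first by apply: Ea; apply: Em.
  move=> x Ux; rewrite -Dg' // -Dh' //.
  by have [] := is_derive_scalarM v (dg _ Ux) (dh _ Ux).
- move=> {}g eg [dg Dg] g0; split=> [x Ux|v].
    by apply: differentiableV; [apply: dg | apply: g0].
  have [g' eg' Dg'] := Dg v.
  exists (fun x => - 1 * (((g x)^-1 * (g x)^-1) * g' x)).
    by do 3?[apply: Em => //]; [exact: Ec | exact: Ei..].
  move=> x Ux; rewrite deriveE; last by apply: differentiableV; [apply: dg | apply: g0].
  rewrite (diffV (dg x Ux) (g0 x Ux)).
  rewrite -Dg' // deriveE /=; last exact: dg.
  by rewrite mulN1r -expr2 exprVn -mulNr; exact.
- move=> h eh [dh Dh].
  have dE x : differentiable (expR : R^o -> R^o) (x : R^o).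
    by apply/derivable1_diffP/derivable_expR.
  have dEh x : U x -> differentiable (fun x => expR (h x) : R^o) x.
    by move=> Ux; apply: (differentiable_comp (dh _ Ux)); exact: dE.
  split=> // v; have [h' eh' Dh'] := Dh v.
  exists (fun x => expR (h x) * h' x); first by apply: Em => //; exact: Ee.
  move=> x Ux; rewrite (deriveE _ (dEh _ Ux)).
  rewrite [X in 'd X x](_ : _ = (expR : R^o -> R^o) \o h) // diff_comp //; last exact: dh.
  rewrite /= -Dh' // (deriveE _ (dh _ Ux)) diff1E //.
  by rewrite derive1E derive_val [LHS]mulrC.
Qed.

Lemma smooth_on_cst (a : R) : smooth_on U (fun=> a : R^o).
Proof. exact/elementary_smooth/Ec. Qed.

Lemma smooth_onD g h : smooth_on U g -> smooth_on U h ->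
  smooth_on U (fun x => g x + h x : R^o).
Proof. by move=> sg sh; apply/elementary_smooth/Ea; exact: Eb. Qed.

Lemma smooth_onM g h : smooth_on U g -> smooth_on U h ->
  smooth_on U (fun x => g x * h x : R^o).
Proof. by move=> sg sh; apply/elementary_smooth/Em; exact: Eb. Qed.

Lemma smooth_onV g : smooth_on U g -> (forall x, U x -> g x != 0) ->
  smooth_on U (fun x => (g x)^-1 : R^o).
Proof. by move=> sg g0; apply/elementary_smooth/Ei => //; exact: Eb. Qed.

Lemma smooth_on_exp g : smooth_on U g -> smooth_on U (fun x => expR (g x) : R^o).
Proof. by move=> sg; apply/elementary_smooth/Ee; exact: Eb. Qed.

Lemma smooth_on_sum (I : Type) (r : seq I) (P : pred I) (g : I -> V -> R^o) :
  (forall i, smooth_on U (g i)) ->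
  smooth_on U (fun x => \sum_(i <- r | P i) g i x : R^o).
Proof.
move=> sg; elim: r => [|i r IHr].
  by apply: smooth_on_eq (smooth_on_cst 0) => // x _; rewrite big_nil.
case Pi: (P i).
  by apply: smooth_on_eq (smooth_onD (sg i) IHr) => // x _; rewrite big_cons Pi.
by apply: smooth_on_eq IHr => // x _; rewrite big_cons Pi.
Qed.

Lemma smooth_on_prod (I : Type) (r : seq I) (P : pred I) (g : I -> V -> R^o) :
  (forall i, smooth_on U (g i)) ->
  smooth_on U (fun x => \prod_(i <- r | P i) g i x : R^o).
Proof.
move=> sg; elim: r => [|i r IHr].
  by apply: smooth_on_eq (smooth_on_cst 1) => // x _; rewrite big_nil.
case Pi: (P i).
  by apply: smooth_on_eq (smooth_onM (sg i) IHr) => // x _; rewrite big_cons Pi.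
by apply: smooth_on_eq IHr => // x _; rewrite big_cons Pi.
Qed.

Lemma smooth_on_det n (A : V -> 'M[R]_n) :
  (forall i j, smooth_on U (fun x => A x i j : R^o)) ->
  smooth_on U (fun x => \det (A x) : R^o).
Proof.
move=> sA; apply: smooth_on_sum => s.
apply: (@smooth_onM (fun=> _)); first exact: smooth_on_cst.
by apply: smooth_on_prod => i; apply: sA.
Qed.

Lemma smooth_on_invmx n (A : V -> 'M[R]_n) :
  (forall i j, smooth_on U (fun x => A x i j : R^o)) ->
  (forall x, U x -> A x \in unitmx) ->
  forall i j, smooth_on U (fun x => invmx (A x) i j : R^o).
Proof.
move=> sA uA i j.
have: smooth_on U (fun x => (\det (A x))^-1 * \adj (A x) i j : R^o).
  apply: smooth_onM.
    apply: smooth_onV; first exact: smooth_on_det.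
    by move=> x Ux; rewrite -unitfE -unitmxE uA.
  apply: (@smooth_on_eq _ _ _ _ _ (fun x => (-1) ^+ (j + i) * \det (row' j (col' i (A x))))) => //.
    by move=> x _; rewrite mxE.
  apply: (@smooth_onM (fun=> _)); first exact: smooth_on_cst.
  apply: smooth_on_det => k l.
  by apply: smooth_on_eq (sA (lift j k) (lift i l)) => // x _; rewrite !mxE.
by apply: smooth_on_eq => // x Ux; rewrite /invmx uA // mxE.
Qed.

End SmoothScalar.

(** * Symmetry of second derivatives *)

Section Schwarz.
Variables (R : realType) (V : normedModType R).

Lemma is_derive_line (g : V -> R^o) y v (s : R) : differentiable g (y + s *: v) ->
  is_derive (s : R) 1 (fun t => g (y + t *: v) : R) ('D_v g (y + s *: v)).
Proof.
move=> /diff_derivable-/(_ v) dg.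
have E : (fun h : R => h^-1 *: (((fun t => g (y + t *: v) : R) \o shift s) (h *: 1)
             - g (y + s *: v))) =
         (fun h => h^-1 *: ((g \o shift (y + s *: v)) (h *: v) - g (y + s *: v))).
  apply/funext => h /=; congr (_ *: (g _ - _)).
  by rewrite [h *: 1]mulr1 scalerDl addrC -addrA [s *: v + _]addrC.
by split; rewrite /derivable /derive E.
Qed.

(** The second difference of [g] on a parallelogram is a mixed second
    derivative at some point of it. *)
Lemma second_difference (g : V -> R^o) U x v w (h : R) :
  smooth_on U g -> 0 < h ->
  (forall s t, 0 <= s <= h -> 0 <= t <= h -> U (x + s *: v + t *: w)) ->
  exists s t, [/\ 0 <= s <= h, 0 <= t <= h &
    (g (x + h *: v + h *: w) - g (x + h *: v)) - (g (x + h *: w) - g x) =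
    h * (h * 'D_w (fun y => 'D_v g y) (x + s *: v + t *: w))].
Proof.
move=> sg h0 inU; have hh : 0 <= h <= h by rewrite ltW /=.
have oo : (0 : R) <= 0 <= h by rewrite lexx ltW.
pose phi (s : R) : R := g (x + h *: w + s *: v) - g (x + s *: v).
have swapE s t : x + t *: w + s *: v = x + s *: v + t *: w by rewrite addrAC.
have dphi (s : R) : 0 <= s <= h -> is_derive s 1 phi
    ('D_v g (x + h *: w + s *: v) - 'D_v g (x + s *: v)).
  move=> sh; apply: is_deriveB; apply: is_derive_line;
    apply: (smooth_on_differentiable sg).
    by rewrite swapE; apply: inU.
  by have := inU s 0 sh oo; rewrite scale0r addr0.
have [||s sI Es] := @MVT R phi
    (fun s => 'D_v g (x + h *: w + s *: v) - 'D_v g (x + s *: v)) 0 h h0.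
- by move=> s; rewrite in_itv /= => /andP[s0 sh]; apply: dphi; rewrite (ltW s0) (ltW sh).
- apply: derivable_within_continuous => s; rewrite in_itv /= => sh.
  by apply: ex_derive; apply: dphi.
move: sI; rewrite in_itv /= => /andP[s0 sh].
have {}sh : 0 <= s <= h by rewrite (ltW s0) (ltW sh).
pose psi (t : R) : R := 'D_v g (x + s *: v + t *: w).
have dpsi (t : R) : 0 <= t <= h -> is_derive t 1 psi
    ('D_w (fun y => 'D_v g y) (x + s *: v + t *: w)).
  move=> th; apply: (@is_derive_line (fun y => 'D_v g y)).
  by apply: (smooth_on_differentiable (smooth_on_derive _ sg)); apply: inU.
have [||t tI Et] := @MVT R psi
    (fun t => 'D_w (fun y => 'D_v g y) (x + s *: v + t *: w)) 0 h h0.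
- by move=> t; rewrite in_itv /= => /andP[t0 th]; apply: dpsi; rewrite (ltW t0) (ltW th).
- apply: derivable_within_continuous => t; rewrite in_itv /= => th.
  by apply: ex_derive; apply: dpsi.
move: tI; rewrite in_itv /= => /andP[t0 th].
exists s, t; rewrite (ltW t0) (ltW th); split => //.
move: Es Et; rewrite /phi /psi !scale0r !addr0 !subr0.
rewrite (swapE h h) (swapE s h) => -> ->; ring.
Qed.

Lemma continuous_meet_eq (A B : V -> R^o) x :
  {for x, continuous A} -> {for x, continuous B} ->
  (forall d, 0 < d -> exists y z, [/\ `|x - y| < d, `|x - z| < d & A y = B z]) ->
  A x = B x.
Proof.
move=> cA cB AB; suff small e : 0 < e -> `|A x - B x| < e.
  apply/eqP; rewrite -subr_eq0 -normr_eq0; case: (eqVneq `|A x - B x| 0) => // n0.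
  by have := small `|A x - B x|; rewrite ltxx => -> //; rewrite lt0r n0 normr_ge0.
move=> e0; have e20 : 0 < e / 2 by rewrite divr_gt0.
have [d1 /= d10 H1] := (nbhs_normP _ _).1 ((cvgrPdist_lt _ _).1 cA _ e20).
have [d2 /= d20 H2] := (nbhs_normP _ _).1 ((cvgrPdist_lt _ _).1 cB _ e20).
have d0 : 0 < Num.min d1 d2 by rewrite lt_min d10 d20.
have [y [z [yd zd yz]]] := AB _ d0.
have {}yd : `|x - y| < d1 by apply: lt_le_trans yd _; rewrite ge_min lexx.
have {}zd : `|x - z| < d2 by apply: lt_le_trans zd _; rewrite ge_min lexx orbT.
have ay := H1 _ yd; have bz := H2 _ zd; rewrite /= in ay bz.
rewrite -(subrK (A y) (A x)) -addrA (splitr e).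
apply: le_lt_trans (ler_normD _ _) _.
by apply: ltrD => //; rewrite yz distrC.
Qed.

(** Schwarz: second derivatives of a smooth function are symmetric. *)
Lemma derive_comm_scalar (g : V -> R^o) U x v w : open U -> U x -> smooth_on U g ->
  'D_v (fun y => 'D_w g y) x = 'D_w (fun y => 'D_v g y) x.
Proof.
move=> oU Ux sg.
apply: (@continuous_meet_eq (fun y => 'D_v (fun y => 'D_w g y) y)
  (fun y => 'D_w (fun y => 'D_v g y) y)).
- by apply/differentiable_continuous/(smooth_on_differentiable _ Ux)/smooth_on_derive/smooth_on_derive.
- by apply/differentiable_continuous/(smooth_on_differentiable _ Ux)/smooth_on_derive/smooth_on_derive.
move=> d d0.
have nU : nbhs x U by apply: open_nbhs_nbhs.
have [d' /= d'0 Hd] := (nbhs_normP _ _).1 nU.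
have m0 : 0 < Num.min d d' by rewrite lt_min d0 d'0.
set c := `|v| + `|w| + 1.
have c0 : 0 < c by rewrite ltr_wpDl // addr_ge0.
pose h := Num.min d d' / c; have h0 : 0 < h by rewrite divr_gt0.
have hd : h * `|v| + h * `|w| < Num.min d d'.
  have : h * c = Num.min d d' by rewrite /h divfK // gt_eqF.
  by rewrite /c => <-; rewrite !mulrDr mulr1 ltrDl.
have hd' : h * `|w| + h * `|v| < Num.min d d' by rewrite addrC.
have inball s t v' w' : h * `|v'| + h * `|w'| < Num.min d d' ->
    0 <= s <= h -> 0 <= t <= h -> `|x - (x + s *: v' + t *: w')| < Num.min d d'.
  move=> hdd /andP[s0 sh] /andP[t0 th]; rewrite -addrA opprD addrA subrr add0r.
  rewrite normrN; apply: le_lt_trans hdd; apply: le_trans (ler_normD _ _) _.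
  by rewrite !normrZ !ger0_norm // lerD // ler_wpM2r.
have inU s t v' w' : h * `|v'| + h * `|w'| < Num.min d d' ->
    0 <= s <= h -> 0 <= t <= h -> U (x + s *: v' + t *: w').
  move=> hdd sh th; apply: Hd; apply: lt_le_trans (inball _ _ _ _ hdd sh th) _.
  by rewrite ge_min lexx orbT.
have ind s t v' w' : h * `|v'| + h * `|w'| < Num.min d d' ->
    0 <= s <= h -> 0 <= t <= h -> `|x - (x + s *: v' + t *: w')| < d.
  move=> hdd sh th; apply: lt_le_trans (inball _ _ _ _ hdd sh th) _.
  by rewrite ge_min lexx.
(* The second difference of [g] does not depend on the order of [v] and [w]. *)
have [s [t [sh th E]]] := second_difference sg h0 (fun s t => inU s t v w hd).
have [s' [t' [sh' th' E']]] := second_difference sg h0 (fun s t => inU s t w v hd').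
exists (x + s' *: w + t' *: v), (x + s *: v + t *: w); split.
- exact: ind.
- exact: ind.
have hn0 : h != 0 by rewrite gt_eqF.
apply: (mulfI hn0); apply: (mulfI hn0).
refine (etrans (etrans (esym E') _) E).
rewrite (addrAC x (h *: w)) opprB addrACA [in RHS]opprB [in RHS]addrACA; congr (_ + _).
by rewrite addrC.
Qed.

End Schwarz.

(** * Smooth vector-valued functions and the Lorentz form *)

Section SmoothVector.
Variables (R : realType) (V : normedModType R) (N : nat).
Implicit Types (g h : V -> 'rV[R]_N) (c : V -> R^o).

Lemma differentiable_entry g x i : differentiable g x ->
  differentiable (fun y => g y 0 i : R^o) x.
Proof.
move=> dg; apply: (@differentiable_comp _ _ _ _ g (fun M : 'rV[R]_N => M 0 i : R^o)) => //.
exact: differentiable_coord.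
Qed.

Lemma derive_entry g x v i : differentiable g x ->
  'D_v (fun y => g y 0 i : R^o) x = ('D_v g x) 0 i.
Proof. by move=> dg; rewrite derive_mx ?mxE //; apply: diff_derivable. Qed.

Lemma differentiable_row g x : (forall i, differentiable (fun y => g y 0 i : R^o) x) ->
  differentiable g x.
Proof.
move=> dg.
rewrite (_ : g = \sum_(i < N) (fun y => (g y 0 i) *: (delta_mx 0 i : 'rV[R]_N))); last first.
  by apply/funext => y; rewrite fct_sumE; exact: row_sum_delta.
by apply: differentiable_sum => i; apply: differentiableZl; apply: dg.
Qed.

Variable U : set V.
Hypothesis oU : open U.

Lemma smooth_on_entry g i : smooth_on U g -> smooth_on U (fun x => g x 0 i : R^o).
Proof.
move=> sg; pose P (h : V -> R^o) := exists2 g : V -> 'rV[R]_N, smooth_on U g & h = (fun x => g x 0 i).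
apply: (@smooth_on_coind R V R^o U P oU); last by exists g.
move=> h [{}g {}sg ->]; split=> [x Ux|v].
  exact/differentiable_entry/(smooth_on_differentiable sg).
exists (fun x => 'D_v g x 0 i).
  by exists (fun x => 'D_v g x) => //; apply: smooth_on_derive.
by move=> x Ux; apply/derive_entry/(smooth_on_differentiable sg).
Qed.

Lemma smooth_on_row g : (forall i, smooth_on U (fun x => g x 0 i : R^o)) -> smooth_on U g.
Proof.
pose P g := forall i, smooth_on U (fun x => g x 0 i : R^o).
apply: (@smooth_on_coind R V _ U P oU).
move=> {}g sg.
have dg x : U x -> differentiable g x.
  by move=> Ux; apply: differentiable_row => i; apply: smooth_on_differentiable (sg i) Ux.
split=> // v; exists (fun x => 'D_v g x) => // i.
apply: smooth_on_eq (smooth_on_derive v (sg i)) => // x Ux.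
by rewrite derive_entry //; apply: dg.
Qed.

Lemma smooth_on_vcst (w : 'rV[R]_N) : smooth_on U (fun=> w).
Proof. by apply: smooth_on_row => i; apply: smooth_on_cst. Qed.

Lemma smooth_on_vD g h : smooth_on U g -> smooth_on U h -> smooth_on U (fun x => g x + h x).
Proof.
move=> sg sh; apply: smooth_on_row => i.
apply: smooth_on_eq (smooth_onD oU (smooth_on_entry i sg) (smooth_on_entry i sh)) => //.
by move=> x _; rewrite mxE.
Qed.

Lemma smooth_on_vZ c h : smooth_on U c -> smooth_on U h -> smooth_on U (fun x => c x *: h x).
Proof.
move=> sg sh; apply: smooth_on_row => i.
apply: smooth_on_eq (smooth_onM oU sg (smooth_on_entry i sh)) => //.
by move=> x _; rewrite mxE.
Qed.

Lemma smooth_on_vN g : smooth_on U g -> smooth_on U (fun x => - g x).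
Proof.
move=> sg; apply: smooth_on_eq (smooth_on_vZ (smooth_on_cst oU (-1)) sg) => // x _.
by rewrite scaleN1r.
Qed.

Lemma smooth_on_vB g h : smooth_on U g -> smooth_on U h -> smooth_on U (fun x => g x - h x).
Proof. by move=> sg sh; apply: smooth_on_vD sg (smooth_on_vN sh). Qed.

Lemma smooth_on_vsum (I : finType) (g : I -> V -> 'rV[R]_N) :
  (forall i, smooth_on U (g i)) -> smooth_on U (fun x => \sum_i g i x).
Proof.
move=> sg; apply: smooth_on_row => k.
have := smooth_on_sum oU (index_enum I) xpredT (fun i => smooth_on_entry k (sg i)).
by apply: smooth_on_eq => // x _; rewrite summxE.
Qed.

(** Schwarz, for vector-valued functions. *)
Lemma derive_comm g x v w : U x -> smooth_on U g ->
  'D_v (fun y => 'D_w g y) x = 'D_w (fun y => 'D_v g y) x.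
Proof.
move=> Ux sg; apply/rowP => i.
have sDg w' := smooth_on_derive w' sg.
have E v' w' : ('D_v' (fun y => 'D_w' g y) x) 0 i =
    'D_v' (fun y => 'D_w' (fun y => g y 0 i : R^o) y) x.
  rewrite -(derive_entry v' i (smooth_on_differentiable (sDg w') Ux)).
  apply: (derive_eq_on _ oU Ux) => y Uy.
  by rewrite -(derive_entry w' i (smooth_on_differentiable sg Uy)).
refine (etrans (E v w) (etrans _ (esym (E w v)))).
exact: (derive_comm_scalar v w oU Ux (smooth_on_entry i sg)).
Qed.

Lemma is_derive_vZ c h x v : differentiable c x -> differentiable h x ->
  differentiable (fun x => c x *: h x) x /\
  'D_v (fun x => c x *: h x) x = 'D_v c x *: h x + c x *: 'D_v h x.
Proof.
move=> dc dh.
have cM i := is_derive_scalarM v dc (differentiable_entry i dh).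
have dch : differentiable (fun x => c x *: h x) x.
  apply: differentiable_row => i; rewrite (_ : (fun y => _) = fun y => c y * h y 0 i).
    by have [] := cM i.
  by apply/funext => y; rewrite mxE.
split=> //; apply/rowP => i; rewrite -derive_entry // (_ : (fun y => _) = fun y => c y * h y 0 i); last first.
  by apply/funext => y; rewrite mxE.
by have [_ ->] := cM i; rewrite !mxE derive_entry.
Qed.

End SmoothVector.

Section LorentzForm.
Variables (R : realType) (N : nat).
Implicit Types x y z t : 'rV[R]_N.

(** The signs of the diagonal form: the last coordinate is the timelike one. *)
Definition lsign (i : 'I_N) : R := if i.+1 == N then -1 else 1.

Lemma lformE x y : lform x y = \sum_i lsign i * (x 0 i * y 0 i).
Proof.
rewrite /lform mxE; apply: eq_bigr => i _.
rewrite mul_mx_diag !mxE /lsign; ring.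
Qed.

Lemma lformC x y : lform x y = lform y x.
Proof. by rewrite !lformE; apply: eq_bigr => i _; rewrite (mulrC (x 0 i)). Qed.

Lemma lformDl x y z : lform (x + y) z = lform x z + lform y z.
Proof. by rewrite /lform !mulmxDl mxE. Qed.

Lemma lformZl a x z : lform (a *: x) z = a * lform x z.
Proof. by rewrite /lform -!scalemxAl mxE. Qed.

Lemma lform0l z : lform 0 z = 0.
Proof. by rewrite /lform !mul0mx mxE. Qed.

Lemma lformNl x z : lform (- x) z = - lform x z.
Proof. by rewrite -scaleN1r lformZl mulN1r. Qed.

Lemma lformBl x y z : lform (x - y) z = lform x z - lform y z.
Proof. by rewrite lformDl lformNl. Qed.

Lemma lform_suml (I : Type) (r : seq I) (P : pred I) (w : I -> 'rV[R]_N) z :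
  lform (\sum_(i <- r | P i) w i) z = \sum_(i <- r | P i) lform (w i) z.
Proof.
apply: (big_morph (fun x => lform x z)); last exact: lform0l.
by move=> x y; rewrite lformDl.
Qed.

Lemma lformDr x y z : lform x (y + z) = lform x y + lform x z.
Proof. by rewrite lformC lformDl !(lformC x). Qed.

Lemma lformZr a x z : lform x (a *: z) = a * lform x z.
Proof. by rewrite lformC lformZl lformC. Qed.

Lemma lform0r z : lform z 0 = 0.
Proof. by rewrite lformC lform0l. Qed.

Lemma lformNr x z : lform x (- z) = - lform x z.
Proof. by rewrite lformC lformNl lformC. Qed.

Lemma lformBr x y z : lform x (y - z) = lform x y - lform x z.
Proof. by rewrite lformDr lformNr. Qed.

Lemma lform_sumr (I : Type) (r : seq I) (P : pred I) (w : I -> 'rV[R]_N) z :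
  lform z (\sum_(i <- r | P i) w i) = \sum_(i <- r | P i) lform z (w i).
Proof. by rewrite lformC lform_suml; apply: eq_bigr => i _; apply: lformC. Qed.

Lemma lform_linearl a x y z : lform (a *: x + y) z = a * lform x z + lform y z.
Proof. by rewrite lformDl lformZl. Qed.

Lemma lform_linearr a x y z : lform z (a *: x + y) = a * lform z x + lform z y.
Proof. by rewrite lformDr lformZr. Qed.

Definition lformL := (lformDl, lformBl, lformNl, lformZl, lform0l).
Definition lformR := (lformDr, lformBr, lformNr, lformZr, lform0r).

(** The orthogonal complement of a timelike vector is Euclidean: in the
    splitting off of the last coordinate this is the reversed Cauchy-Schwarz
    inequality. *)
Lemma lform_spacelike t x : lform t t = -1 -> lform x t = 0 -> x != 0 ->
  0 < lform x x.
Proof.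
case: N t x => [|m] t x; first by move=> _ _; rewrite thinmx0 eqxx.
pose S (y z : 'rV[R]_m.+1) := \sum_(i < m) y 0 (widen_ord (leqnSn m) i) * z 0 (widen_ord (leqnSn m) i).
have lS (y z : 'rV[R]_m.+1) : lform y z = S y z - y 0 ord_max * z 0 ord_max.
  rewrite /lform mxE big_ord_recr /=; congr (_ + _).
    apply: eq_bigr => i _; rewrite mul_mx_diag !mxE /= eqSS ltn_eqF ?mulr1 //.
  by rewrite mul_mx_diag !mxE /= eqxx; ring.
have SS (y : 'rV[R]_m.+1) : 0 <= S y y by apply: sumr_ge0 => i _; rewrite -expr2 sqr_ge0.
(* Cauchy-Schwarz for the spacelike coordinates. *)
have CS : S x t ^+ 2 <= S x x * S t t.
  have [tt0|ttn0] := eqVneq (S t t) 0.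
    have t0 i : t 0 (widen_ord (leqnSn m) i) = 0.
      move/eqP: tt0; rewrite psumr_eq0 => [/allP/(_ i)|j _]; last by rewrite -expr2 sqr_ge0.
      by rewrite mem_index_enum -expr2 sqrf_eq0 => /(_ isT)/eqP.
    by rewrite tt0 mulr0 /S big1 ?expr0n //= => i _; rewrite t0 mulr0.
  have tt_gt0 : 0 < S t t by rewrite lt0r ttn0 SS.
  have : 0 <= S (S t t *: x - S x t *: t) (S t t *: x - S x t *: t) by [].
  have -> : S (S t t *: x - S x t *: t) (S t t *: x - S x t *: t) =
      S t t * (S x x * S t t - S x t ^+ 2).
    have SE (a b : R) : S (a *: x - b *: t) (a *: x - b *: t) =
        a ^+ 2 * S x x - 2 * a * b * S x t + b ^+ 2 * S t t.
      rewrite /S !mulr_sumr -sumrB -big_split /=; apply: eq_bigr => i _.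
      by rewrite !mxE; ring.
    by rewrite SE; ring.
  by rewrite pmulr_rge0 // subr_ge0.
rewrite !lS => tt xt xn0; set a := x 0 ord_max in xt *; set b := t 0 ord_max in tt xt.
have Sx : 0 < S x x.
  rewrite lt0r SS andbT; apply: contra xn0 => /eqP xx0.
  have x0 i : x 0 (widen_ord (leqnSn m) i) = 0.
    move/eqP: xx0; rewrite psumr_eq0 => [/allP/(_ i)|j _]; last by rewrite -expr2 sqr_ge0.
    by rewrite mem_index_enum -expr2 sqrf_eq0 => /(_ isT)/eqP.
  have bn0 : b != 0.
    apply/eqP => b0; move: tt; rewrite b0 mul0r subr0 => tt.
    by have := SS t; rewrite tt oppr_ge0 ler10.
  have a0 : a = 0.
    move/eqP: xt; rewrite [S x t](_ : _ = 0); last by rewrite /S big1 // => i _; rewrite x0 mul0r.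
    by rewrite sub0r oppr_eq0 mulf_eq0 (negPf bn0) orbF => /eqP.
  apply/eqP/rowP => i; rewrite mxE; case: (unliftP ord_max i) => [j ->|->] //.
  by rewrite -(x0 j); congr (x 0 _); apply/val_inj; rewrite /= /bump leqNgt ltn_ord.
have St := SS t; have {}xt : S x t = a * b by apply/eqP; rewrite -subr_eq0 xt.
have {tt} tt : S t t = b ^+ 2 - 1 by rewrite expr2; lra.
have b1 : 1 <= b ^+ 2 by rewrite -subr_ge0 -tt.
have key : a ^+ 2 * b ^+ 2 < S x x * b ^+ 2.
  rewrite -exprMn -xt; apply: le_lt_trans CS _.
  by rewrite ltr_pM2l // tt; lra.
move: key; rewrite ltr_pM2r; last by apply: lt_le_trans b1.
by rewrite expr2 subr_gt0.
Qed.

End LorentzForm.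

Lemma derive_sum_fin (R : realType) (V W : normedModType R) (I : finType) (f : I -> V -> W) x v :
  (forall i, differentiable (f i) x) ->
  'D_v (fun y => \sum_i f i y) x = \sum_i 'D_v (f i) x.
Proof.
move=> df; suff [_] : differentiable (fun y => \sum_i f i y) x /\
  'D_v (fun y => \sum_i f i y) x = \sum_i 'D_v (f i) x by [].
elim: (index_enum I) => [|i r [IHd IH]].
  rewrite big_nil (_ : (fun y => _) = cst 0 :> (V -> W)); last by apply/funext => y; rewrite big_nil.
  by split; [exact: differentiable_cst | exact: derive_cst].
rewrite big_cons (_ : (fun y => _) = f i + (fun y => \sum_(j <- r) f j y)); last first.
  by apply/funext => y; rewrite big_cons.
split; first exact: differentiableD.
by rewrite deriveD ?IH //; apply: diff_derivable.
Qed.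

Section LorentzCalculus.
Variables (R : realType) (V : normedModType R) (N : nat).
Implicit Types (g h : V -> 'rV[R]_N).

Lemma smooth_on_lform U g h : open U -> smooth_on U g -> smooth_on U h ->
  smooth_on U (fun x => lform (g x) (h x) : R^o).
Proof.
move=> oU sg sh.
have s i : smooth_on U (fun x => lsign R i * (g x 0 i * h x 0 i) : R^o).
  apply: (@smooth_onM _ _ _ oU (fun=> _)); first exact: smooth_on_cst.
  by apply: smooth_onM => //; apply: smooth_on_entry.
apply: smooth_on_eq (smooth_on_sum oU (index_enum 'I_N) xpredT s) => // x _.
exact: lformE.
Qed.

Lemma derive_lform g h x v : differentiable g x -> differentiable h x ->
  'D_v (fun y => lform (g y) (h y) : R^o) x =
  lform ('D_v g x) (h x) + lform (g x) ('D_v h x).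
Proof.
move=> dg dh.
have cM i := is_derive_scalarM v (differentiable_entry i dg) (differentiable_entry i dh).
have sM i := is_derive_scalarM v (differentiable_cst (lsign R i : R^o) x) (cM i).1.
rewrite (_ : (fun y => _) = fun y => \sum_i lsign R i * (g y 0 i * h y 0 i)); last first.
  by apply/funext => y; rewrite lformE.
rewrite (@derive_sum_fin _ _ R^o) => [|i]; last by have [] := sM i.
rewrite !lformE -big_split /=; apply: eq_bigr => i _.
have [_ E] := sM i; rewrite [LHS]E; have [_ ->] := cM i; rewrite derive_cst !derive_entry //.
by rewrite mul0r add0r mulrDr.
Qed.

End LorentzCalculus.

(** * Directional derivatives *)

(** The derivative of [g] at [x] in the direction [X].  The definition is
    sealed: unfolding a derivative into a limit when two terms are compared is
    prohibitively expensive. *)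
HB.lock Definition dd (R : realType) (V W : normedModType R) (g : V -> W) (x X : V) : W :=
  'D_X g x.

Lemma ddE (R : realType) (V W : normedModType R) (g : V -> W) (x X : V) :
  'D_X g x = dd g x X.
Proof. by rewrite dd.unlock. Qed.

Section DirectionalDerivative.
Variables (R : realType) (V W : normedModType R) (N : nat) (U : set V).
Hypothesis oU : open U.

Lemma smooth_on_dd (g : V -> W) X : smooth_on U g -> smooth_on U (fun x => dd g x X).
Proof. by rewrite dd.unlock; exact: smooth_on_derive. Qed.

Lemma dd_eq_on (g h : V -> W) x X : U x -> (forall y, U y -> g y = h y) ->
  dd g x X = dd h x X.
Proof. by rewrite dd.unlock => Ux; exact: derive_eq_on oU Ux. Qed.

Lemma dd_cst (w : W) (x X : V) : dd (fun=> w) x X = 0.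
Proof. by rewrite dd.unlock; exact: derive_cst. Qed.

Lemma ddDl (g : V -> W) x X Y : smooth_on U g -> U x -> dd g x (X + Y) = dd g x X + dd g x Y.
Proof.
rewrite dd.unlock => sg Ux; rewrite -{1}(scale1r X) deriveDl ?scale1r //.
exact: smooth_on_differentiable sg Ux.
Qed.

Lemma ddZl (g : V -> W) x a X : smooth_on U g -> U x -> dd g x (a *: X) = a *: dd g x X.
Proof.
rewrite dd.unlock => sg Ux; rewrite -{1}[a *: X]addr0 deriveDl ?derive0 ?addr0 //.
exact: smooth_on_differentiable sg Ux.
Qed.

Lemma ddD (g h : V -> W) x X : smooth_on U g -> smooth_on U h -> U x ->
  dd (fun y => g y + h y) x X = dd g x X + dd h x X.
Proof.
rewrite dd.unlock => sg sh Ux; apply: deriveD; apply: diff_derivable.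
  exact: smooth_on_differentiable sg Ux.
exact: smooth_on_differentiable sh Ux.
Qed.

Lemma ddN (g : V -> W) x X : smooth_on U g -> U x ->
  dd (fun y => - g y) x X = - dd g x X.
Proof.
rewrite dd.unlock => sg Ux; apply: deriveN; apply: diff_derivable.
exact: smooth_on_differentiable sg Ux.
Qed.

Lemma ddB (g h : V -> W) x X : smooth_on U g -> smooth_on U h -> U x ->
  dd (fun y => g y - h y) x X = dd g x X - dd h x X.
Proof.
rewrite dd.unlock => sg sh Ux; apply: deriveB; apply: diff_derivable.
  exact: smooth_on_differentiable sg Ux.
exact: smooth_on_differentiable sh Ux.
Qed.

Lemma ddC (g : V -> 'rV[R]_N) x X Y : smooth_on U g -> U x ->
  dd (fun y => dd g y Y) x X = dd (fun y => dd g y X) x Y.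
Proof. by rewrite dd.unlock => sg Ux; exact: (derive_comm oU). Qed.

Lemma dd_lform (g h : V -> 'rV[R]_N) x X : smooth_on U g -> smooth_on U h -> U x ->
  dd (fun y => lform (g y) (h y) : R^o) x X =
  lform (dd g x X) (h x) + lform (g x) (dd h x X).
Proof.
rewrite dd.unlock => sg sh Ux; apply: derive_lform.
  exact: smooth_on_differentiable sg Ux.
exact: smooth_on_differentiable sh Ux.
Qed.

Lemma dd_vZ (c : V -> R^o) (h : V -> 'rV[R]_N) x X : smooth_on U c -> smooth_on U h -> U x ->
  dd (fun y => c y *: h y) x X = dd c x X *: h x + c x *: dd h x X.
Proof.
rewrite dd.unlock => sc sh Ux.
have dc : differentiable c x by exact: smooth_on_differentiable sc Ux.
have dh : differentiable h x by exact: smooth_on_differentiable sh Ux.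
by have [_ ->] := is_derive_vZ X dc dh.
Qed.

Lemma dd_exp (u : V -> R^o) x X : smooth_on U u -> U x ->
  dd (fun y => expR (u y) : R^o) x X = expR (u x) * dd u x X.
Proof.
rewrite dd.unlock => su Ux.
have du : differentiable u x by exact: smooth_on_differentiable su Ux.
have dE : differentiable (expR : R^o -> R^o) (u x : R^o).
  by apply/derivable1_diffP/derivable_expR.
have dEu : differentiable (fun x => expR (u x) : R^o) x.
  by apply: (differentiable_comp du); exact: dE.
rewrite (deriveE _ dEu) [X in 'd X x](_ : _ = (expR : R^o -> R^o) \o u) //.
rewrite diff_comp // /= (deriveE _ du) diff1E //.
by rewrite derive1E derive_val [LHS]mulrC.
Qed.

End DirectionalDerivative.

Lemma dd_sum (R : realType) (V W : normedModType R) (U : set V) (I : finType) (g : I -> V -> W) x X :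
  open U -> (forall i, smooth_on U (g i)) -> U x ->
  dd (fun y => \sum_i g i y) x X = \sum_i dd (g i) x X.
Proof.
rewrite dd.unlock => oU sg Ux.
by apply: derive_sum_fin => i; exact: smooth_on_differentiable (sg i) Ux.
Qed.

(** * Simultaneous diagonalization of self-adjoint operators *)

Section Spectral.
Variable R : rcfType.

(** The real polynomial with the complex roots [a + i b] and [a - i b]. *)
Definition quad (a b : R) : {poly R} := ('X - a%:P) ^+ 2 + (b ^+ 2)%:P.

Lemma size_quad a b : size (quad a b) = 3.
Proof.
rewrite /quad size_polyDl size_exp_XsubC // (leq_ltn_trans (size_polyC_leq1 _)) //.
Qed.

Lemma quad_dvd_of_root (p : {poly R}) (a b : R) : b != 0 ->
  root (map_poly (real_complex R) p) (Complex a b) -> quad a b %| p.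
Proof.
move=> b0 /rootP pz; rewrite /dvdp; set r := p %% quad a b.
have sr : (size r <= 2)%N.
  by have := ltn_modp p (quad a b); rewrite -size_poly_gt0 size_quad ltnS => ->.
have rE : r = r`_1 *: 'X + (r`_0)%:P.
  apply/polyP => i; rewrite coefD coefZ coefX coefC.
  case: i => [|[|i]] /=; rewrite ?mulr0 ?mulr1 ?add0r ?addr0 //.
  by rewrite nth_default // (leq_trans sr).
have rz : (map_poly (real_complex R) r).[Complex a b] = 0.
  have := divp_eq p (quad a b) => /(congr1 (fun q => (map_poly (real_complex R) q).[Complex a b])).
  rewrite rmorphD rmorphM /= !hornerE pz -/r.
  rewrite [X in _ * X](_ : _ = 0) ?mulr0 ?add0r // /quad.
  rewrite rmorphD rmorphXn rmorphB /= map_polyX !map_polyC /= !hornerE.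
  by apply/eqP; rewrite eq_complex /=; apply/andP; split; apply/eqP; ring.
move: rz; rewrite rE rmorphD /= map_polyZ map_polyX map_polyC /= !hornerE.
move=> /eqP; rewrite eq_complex /= => /andP[/eqP re /eqP im].
have r1 : r`_1 = 0.
  by move: im; rewrite mul0r !addr0 => /eqP; rewrite mulf_eq0 (negPf b0) orbF => /eqP.
have r0 : r`_0 = 0 by move: re; rewrite r1 !mul0r subr0 add0r.
by rewrite r1 r0 scale0r add0r.
Qed.

Variables (m : nat) (G : 'M[R]_m.+1).
Hypothesis Gpos : forall x : 'rV[R]_m.+1, x != 0 -> 0 < (x *m G *m x^T) 0 0.

Let ip (x y : 'rV[R]_m.+1) : R := (x *m G *m y^T) 0 0.

(** The minimal polynomial of a self-adjoint operator [A] has no factor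
    [(X - a)^2 + b^2], for [b = 0] included: if [w] is in the image of the
    cofactor evaluated at [A], then [|w (A - a)|^2 + b^2 |w|^2 = 0], so that
    already [X - a] or [1], times the cofactor, annihilates [A]. *)
Lemma selfadjoint_quad (A : 'M[R]_m.+1) (a b : R) : A *m G = G *m A^T ->
  ~~ (quad a b %| mxminpoly A).
Proof.
move=> sA; apply/negP => /dvdpP[r pE].
have p0 : mxminpoly A != 0 by rewrite monic_neq0 // mxminpoly_monic.
have r0 : r != 0 by apply: contra p0 => /eqP r0; rewrite pE r0 mul0r.
have BG : (A - a%:M) *m G = G *m (A - a%:M)^T.
  rewrite [(A - a%:M)^T]linearB /= tr_scalar_mx mulmxBl mulmxBr sA.
  by rewrite mul_mx_scalar mul_scalar_mx.
have Aself x y : ip (x *m (A - a%:M)) y = ip x (y *m (A - a%:M)).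
  by rewrite /ip trmx_mul -(mulmxA x) BG !mulmxA.
pose B := A - a%:M.
have qE : horner_mx A (quad a b) = B *m B + (b ^+ 2)%:M.
  rewrite /quad rmorphD rmorphXn rmorphB /= horner_mx_X !horner_mx_C.
  by rewrite expr2.
have key (v : 'rV[R]_m.+1) : let w := v *m horner_mx A r in w *m B = 0 /\ b *: w = 0.
  move=> w; have : w *m (B *m B + (b ^+ 2)%:M) = 0.
    rewrite -qE /w -mulmxA -[_ *m horner_mx A (quad a b)]rmorphM /= -pE mx_root_minpoly.
    by rewrite mulmx0.
  move=> E; have : ip (w *m B) (w *m B) + b ^+ 2 * ip w w = 0.
    rewrite -Aself -/B -mulmxA (_ : w *m (B *m B) = - (b ^+ 2 *: w)); last first.
      by apply/eqP; rewrite -addr_eq0 -[b ^+ 2 *: w]mul_mx_scalar -mulmxDr E.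
    by rewrite /ip !mulNmx -!scalemxAl !mxE; ring.
  have ip0 x : 0 <= ip x x.
    by have [->|/Gpos/ltW//] := eqVneq x 0; rewrite /ip !mul0mx mxE.
  have ip_eq0 x : ip x x = 0 -> x = 0.
    by move=> x0; apply/eqP/negPn/negP => /Gpos; rewrite -/(ip x x) x0 ltxx.
  move=> sum0; have bw := mulr_ge0 (sqr_ge0 b) (ip0 w).
  have wB := ip0 (w *m B).
  split; first by apply: ip_eq0; lra.
  have ipZ : ip (b *: w) (b *: w) = b ^+ 2 * ip w w.
    rewrite /ip [(b *: w)^T]linearZ /= -!scalemxAl -scalemxAr.
    by set M := _ *m _ *m _; rewrite mxE mxE mulrA -expr2.
  by apply: ip_eq0; rewrite ipZ; lra.
have rmin s : horner_mx A s = 0 -> s != 0 -> (size r + 2 <= size s)%N.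
  move=> /mxminpoly_min; rewrite pE => /dvdp_leq H /H.
  have q0 : quad a b != 0 by rewrite -size_poly_gt0 size_quad.
  by rewrite size_mul // size_quad addn3 addn2.
have hrow (C : 'M[R]_m.+1) : (forall v : 'rV_m.+1, v *m C = 0) -> C = 0.
  by move=> C0; apply/row_matrixP => i; rewrite rowE C0 row0.
have [b0|b0] := eqVneq b 0; last first.
  have : horner_mx A r = 0.
    apply: hrow => v; have [_ /eqP] := key v.
    by rewrite scaler_eq0 (negPf b0) => /eqP.
  by move=> /rmin/(_ r0); rewrite addn2 ltnNge leqnSn.
have : horner_mx A (r * ('X - a%:P)) = 0.
  apply: hrow => v; rewrite rmorphM rmorphB /= horner_mx_X horner_mx_C mulmxA.
  by have [] := key v.
move=> /rmin/(_ _); rewrite mulf_neq0 ?polyXsubC_eq0 // => /(_ isT).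
by rewrite size_Mmonic ?monicXsubC // size_XsubC addn2 /= ltnn.
Qed.

(** Hence the minimal polynomial is a product of distinct real linear factors. *)
Lemma selfadjoint_diagonalizable (A : 'M[R]_m.+1) : A *m G = G *m A^T ->
  diagonalizable A.
Proof.
move=> sA; apply/diagonalizableP.
have p0 : mxminpoly A != 0 by rewrite monic_neq0 // mxminpoly_monic.
suff H k (r : {poly R}) : (size r <= k)%N -> r != 0 -> r %| mxminpoly A ->
    exists rs, [/\ uniq rs, all (root r) rs & r %| \prod_(x <- rs) ('X - x%:P)].
  by have [rs [urs _ rsp]] := H _ _ (leqnn _) p0 (dvdpp _); exists rs.
elim: k r => [|k IHk] r sr r0 rp; first by move: r0; rewrite -size_poly_leq0 sr.
have [sr1|sr1] := leqP (size r) 1.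
  exists [::]; split=> //; rewrite big_nil dvdp1 eqn_leq sr1 /=.
  by rewrite size_poly_gt0.
have /closed_rootP[[a b] rz] : size (map_poly (real_complex R) r) != 1%N.
  by rewrite size_map_poly gtn_eqF.
have [b0|b0] := eqVneq b 0; last first.
  have := dvdp_trans (quad_dvd_of_root b0 rz) rp.
  by rewrite (negPf (selfadjoint_quad a b sA)).
have ra : root r a.
  move: rz; rewrite b0 -[Complex a 0]/(real_complex R a) /root horner_map /=.
  by rewrite eq_complex /= => /andP[].
have /factor_theorem[q rE] := ra.
have q0 : q != 0 by apply: contra r0 => /eqP q0; rewrite rE q0 mul0r.
have sq : (size q <= k)%N.
  by move: sr; rewrite rE size_Mmonic ?monicXsubC // size_XsubC addn2.
have qp : q %| mxminpoly A by apply: dvdp_trans rp; rewrite rE dvdp_mulr.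
have [rs [urs rrs qrs]] := IHk q sq q0 qp.
exists (a :: rs); split.
- rewrite /= urs andbT; apply/negP => /(allP rrs) /factor_theorem[s qE].
  have := selfadjoint_quad a 0 sA; rewrite /quad expr0n /= addr0.
  rewrite (dvdp_trans _ rp) // rE qE -mulrA -expr2.
  exact: dvdp_mull.
- rewrite /= ra; apply/allP => x /(allP rrs); rewrite rE !rootM => ->; exact: erefl.
- by rewrite big_cons mulrC rE dvdp_mul.
Qed.

(** A finite family of commuting self-adjoint operators has a basis of common
    eigenvectors. *)
Lemma common_eigenbasis (As : seq 'M[R]_m.+1) :
  {in As, forall A, A *m G = G *m A^T} ->
  {in As &, forall A B, A *m B = B *m A} ->
  exists2 P : 'M[R]_m.+1, P \in unitmx &
    {in As, forall A, exists d : 'rV[R]_m.+1, forall i, row i P *m A = d 0 i *: row i P}.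
Proof.
move=> sAs cAs.
have /codiagonalizableP[P uP /allP dP] :
    {in As &, forall A B, comm_mx A B} /\ {in As, forall A, diagonalizable A}.
  by split=> [A B|A AAs]; [exact: cAs | apply/selfadjoint_diagonalizable/sAs].
exists P => // A /dP /diagonalizable_forPex[d /(simmxP uP) PA].
by exists d => i; rewrite -row_mul PA row_mul row_diag_mx -scalemxAl -rowE.
Qed.

End Spectral.

Section DiagonalSpace.
Variables (K : fieldType) (n : nat) (P : 'M[K]_n).
Hypothesis uP : P \in unitmx.

(** The projection onto the line spanned by the [k]-th row of [P], along the
    other rows. *)
Definition row_proj k : 'M[K]_n := invmx P *m delta_mx k k *m P.

Lemma row_projE i k : row i P *m row_proj k = (i == k)%:R *: row i P.
Proof.
rewrite /row_proj -mulmxA rowE !mulmxA mulmxK // mul_delta_mx_cond.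
by case: eqP => [->|_]; rewrite ?mulr1n ?mulr0n ?scale1r ?mul0mx ?scale0r.
Qed.

Lemma eq_on_rows (A B : 'M[K]_n) : (forall i, row i P *m A = row i P *m B) -> A = B.
Proof.
move=> AB; rewrite -(mulKmx uP A) -(mulKmx uP B); congr (_ *m _).
by apply/row_matrixP => i; rewrite !row_mul AB.
Qed.

Lemma row_proj_sum (A : 'M[K]_n) (d : 'I_n -> K) : (forall i, row i P *m A = d i *: row i P) ->
  A = \sum_k d k *: row_proj k.
Proof.
move=> dA; apply: eq_on_rows => i; rewrite dA mulmx_sumr (bigD1 i) //= big1.
  by rewrite -scalemxAr row_projE eqxx scale1r addr0.
by move=> k ki; rewrite -scalemxAr row_projE eq_sym (negPf ki) scale0r scaler0.
Qed.

Lemma nth_row_proj (k : 'I_n) : [seq row_proj k | k <- enum 'I_n]`_k = row_proj k.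
Proof. by rewrite (nth_map k) ?size_enum_ord ?ltn_ord // nth_ord_enum. Qed.

(** The matrices that are diagonal in the basis of the rows of [P]. *)
Definition row_proj_space : {vspace 'M[K]_n} := <<[seq row_proj k | k <- enum 'I_n]>>%VS.

Lemma row_proj_spaceP A :
  A \in row_proj_space <-> exists d : 'I_n -> K, A = \sum_k d k *: row_proj k.
Proof.
split=> [|[d ->]]; last first.
  by apply: memv_suml => k _; apply/memvZ/memv_span/map_f; rewrite mem_enum.
rewrite /row_proj_space; set X := [seq _ | _ <- _].
move=> /(coord_span (X := in_tuple X)) ->.
have sX : size X = n by rewrite size_map size_enum_ord.
exists (fun k => coord (in_tuple X) (cast_ord (esym sX) k) A).
rewrite (reindex (cast_ord sX)) /=; last first.
  by exists (cast_ord (esym sX)) => i _; rewrite ?cast_ordK ?cast_ordKV.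
apply: eq_bigr => k _; rewrite cast_ordK; congr (_ *: _).
exact: (nth_row_proj (cast_ord sX k)).
Qed.

Lemma dim_row_proj_space : \dim row_proj_space = n.
Proof.
rewrite /row_proj_space; set X := [seq _ | _ <- _].
have sX : size X = n by rewrite size_map size_enum_ord.
rewrite -[RHS]sX; apply/eqP; suff: free (in_tuple X) by move=> /eqP ->.
apply/freeP => c c0 i.
have nthX (k : 'I_(size X)) : (in_tuple X)`_k = row_proj (cast_ord sX k).
  exact: (nth_row_proj (cast_ord sX k)).
have := congr1 (fun A => row (cast_ord sX i) P *m A) c0.
rewrite mulmx0 mulmx_sumr (bigD1 i) //= big1 => [|k ki]; last first.
  rewrite nthX -scalemxAr row_projE (inj_eq (@cast_ord_inj _ _ sX)) eq_sym (negPf ki).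
  by rewrite scale0r scaler0.
rewrite nthX -scalemxAr row_projE eqxx scale1r addr0 => /eqP.
rewrite scaler_eq0 => /orP[/eqP//|/eqP ri0].
have := mulmxV uP => /(congr1 (row (cast_ord sX i))).
rewrite row_mul ri0 mul0mx => /rowP/(_ (cast_ord sX i)).
by rewrite !mxE eqxx => /esym/eqP; rewrite oner_eq0.
Qed.

(** A space of matrices diagonal in the basis of the rows of [P], two of whose
    eigenvalues always agree, is not of maximal dimension. *)
Lemma dim_equal_eigenvalues (S : {vspace 'M[K]_n}) i j : i != j ->
  (forall A, A \in S -> exists2 d : 'I_n -> K, d i = d j &
     forall k, row k P *m A = d k *: row k P) ->
  (\dim S < n)%N.
Proof.
move=> ij Sd; pose B k := row_proj k + (k == i)%:R *: row_proj j.
have SB : (S <= <<[seq B k | k <- enum (predC1 j)]>>)%VS.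
  apply/subvP => A /Sd[d dij dA]; rewrite (row_proj_sum dA) (bigD1 j) //=.
  have -> : d j *: row_proj j + \sum_(k < n | k != j) d k *: row_proj k =
      \sum_(k < n | k != j) d k *: B k.
    under [RHS]eq_bigr => k _ do rewrite scalerDr.
    rewrite big_split /= addrC; congr (_ + _).
    rewrite (bigD1 i) //= eqxx scale1r dij big1 ?addr0 // => k /andP[_ /negPf ->].
    by rewrite scale0r scaler0.
  apply: memv_suml => k kj; apply/memvZ/memv_span/map_f.
  by rewrite mem_enum.
apply: leq_ltn_trans (dimvS SB) _; apply: leq_ltn_trans (dim_span _) _.
rewrite size_map -cardE cardC1 card_ord.
by case: n i {ij Sd B SB} => [[]|m] //.
Qed.

End DiagonalSpace.

Lemma commuting_selfadjoint_eigenbasis (R : rcfType) n (G : 'M[R]_n) (As : seq 'M[R]_n) :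
  (forall x : 'rV[R]_n, x != 0 -> 0 < (x *m G *m x^T) 0 0) ->
  {in As, forall A, A *m G = G *m A^T} ->
  {in As &, forall A B, A *m B = B *m A} ->
  exists2 P : 'M[R]_n, P \in unitmx &
    {in As, forall A, exists d : 'rV[R]_n, forall i, row i P *m A = d 0 i *: row i P}.
Proof.
case: n G As => [|m] G As Gpos sA cA; last exact: (common_eigenbasis Gpos sA cA).
by exists 1%:M; [exact: unitmx1 | move=> A _; exists 0 => -[]].
Qed.

(** * Local geometry of an immersion *)

Lemma oproj_eq (R : realType) N (S : set 'rV[R]_N) v w :
  (forall a b, S a -> S b -> S (a - b)) ->
  (forall a, S a -> (forall z, S z -> lform a z = 0) -> a = 0) ->
  S w -> (forall z, S z -> lform (v - w) z = 0) -> oproj S v = w.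
Proof.
move=> SB S0 Sw vw; apply: xget_unique => // w' [Sw' vw'].
apply/eqP; rewrite -subr_eq0; apply/eqP/S0; first exact: SB.
by move=> z Sz; have := vw z Sz; have := vw' z Sz; rewrite !lformL; lra.
Qed.

Section Immersed.
Variables (R : realType) (n N : nat) (U : set 'rV[R]_n) (g : 'rV[R]_n -> 'rV[R]_N).
Hypotheses (oU : open U) (sg : smooth_on U g).
Hypothesis g_spacelike : forall x, U x -> forall X, X != 0 ->
  0 < lform (dd g x X) (dd g x X).

(** The second derivative of [g] at [x]. *)
Definition hess x X Y : 'rV[R]_N := dd (fun y => dd g y Y) x X.

Lemma tangentD x X Y : U x -> dd g x (X + Y) = dd g x X + dd g x Y.
Proof. exact: ddDl. Qed.

Lemma tangentZ x a X : U x -> dd g x (a *: X) = a *: dd g x X.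
Proof. exact: ddZl. Qed.

Lemma tangent0 x : U x -> dd g x 0 = 0.
Proof. by move=> Ux; rewrite -(scale0r 0) tangentZ // scale0r. Qed.

Lemma tangentN x X : U x -> dd g x (- X) = - dd g x X.
Proof. by move=> Ux; rewrite -scaleN1r tangentZ // scaleN1r. Qed.

Lemma tangentB x X Y : U x -> dd g x (X - Y) = dd g x X - dd g x Y.
Proof. by move=> Ux; rewrite tangentD // tangentN. Qed.

Lemma tangent_sum x X : U x -> dd g x X = \sum_i X 0 i *: dd g x (delta_mx 0 i).
Proof.
move=> Ux; rewrite {1}(row_sum_delta X).
elim: (index_enum 'I_n) => [|i r IHr]; first by rewrite !big_nil tangent0.
by rewrite !big_cons tangentD // tangentZ // IHr.
Qed.

Let sdg X : smooth_on U (fun x => dd g x X).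
Proof. exact: smooth_on_dd. Qed.

Lemma hessDl x X X' Y : U x -> hess x (X + X') Y = hess x X Y + hess x X' Y.
Proof. exact: ddDl (sdg Y). Qed.

Lemma hessZl x a X Y : U x -> hess x (a *: X) Y = a *: hess x X Y.
Proof. exact: ddZl (sdg Y). Qed.

Lemma hessC x X Y : U x -> hess x X Y = hess x Y X.
Proof. exact: (ddC oU X Y sg). Qed.

Lemma hessDr x X Y Y' : U x -> hess x X (Y + Y') = hess x X Y + hess x X Y'.
Proof. by move=> Ux; rewrite (hessC X) // hessDl // (hessC Y) // (hessC Y'). Qed.

Lemma hessZr x a X Y : U x -> hess x X (a *: Y) = a *: hess x X Y.
Proof. by move=> Ux; rewrite (hessC X) // hessZl // (hessC Y). Qed.

Lemma hessNr x X Y : U x -> hess x X (- Y) = - hess x X Y.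
Proof. by move=> Ux; rewrite -scaleN1r hessZr // scaleN1r. Qed.

(** The matrix of the induced metric. *)
Definition gram x : 'M[R]_n :=
  \matrix_(i, j) lform (dd g x (delta_mx 0 i)) (dd g x (delta_mx 0 j)).

Lemma induced_metric_gram x : induced_metric g x = gram x.
Proof. by rewrite /gram dd.unlock. Qed.

Lemma gramE x X Y : U x -> lform (dd g x X) (dd g x Y) = (X *m gram x *m Y^T) 0 0.
Proof.
move=> Ux; rewrite (tangent_sum X) // (tangent_sum Y) // mxE lform_sumr.
apply: eq_bigr => j _; rewrite lformZr lform_suml !mxE mulrC; congr (_ * _).
by apply: eq_bigr => i _; rewrite lformZl mxE.
Qed.

Lemma gram_tr x : (gram x)^T = gram x.
Proof. by apply/matrixP => i j; rewrite !mxE lformC. Qed.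

Lemma gram_unit x : U x -> gram x \in unitmx.
Proof.
move=> Ux; rewrite -row_free_unit -kermx_eq0; apply/negP => /negP /rowV0Pn[X].
move=> /sub_kermxP XG Xn0; have := g_spacelike Ux Xn0.
by rewrite gramE // XG mul0mx mxE ltxx.
Qed.

(** Coordinates of the tangential part of [z] at [x], that tangential part,
    and the normal part. *)
Definition tcoef x (z : 'rV[R]_N) : 'rV[R]_n :=
  (\row_j lform z (dd g x (delta_mx 0 j))) *m invmx (gram x).
Definition tpart x z : 'rV[R]_N := dd g x (tcoef x z).
Definition npart x z : 'rV[R]_N := z - tpart x z.

Lemma tcoef_linear x a z w : tcoef x (a *: z + w) = a *: tcoef x z + tcoef x w.
Proof.
rewrite /tcoef scalemxAl -mulmxDl; congr (_ *m _); apply/rowP => j.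
by rewrite !mxE lformDl lformZl.
Qed.

Lemma npart_linear x a z w : U x -> npart x (a *: z + w) = a *: npart x z + npart x w.
Proof.
move=> Ux; rewrite /npart /tpart tcoef_linear tangentD // tangentZ // scalerBr.
by rewrite opprD addrACA.
Qed.

Lemma lform_tpart x z Y : U x -> lform (tpart x z) (dd g x Y) = lform z (dd g x Y).
Proof.
move=> Ux; rewrite /tpart gramE // /tcoef mulmxKV ?gram_unit //.
rewrite mxE (tangent_sum Y) // lform_sumr; apply: eq_bigr => i _.
by rewrite !mxE lformZr mulrC.
Qed.

Lemma npart_normal x z Y : U x -> lform (npart x z) (dd g x Y) = 0.
Proof. by move=> Ux; rewrite lformBl lform_tpart // subrr. Qed.

Lemma lform_npart x z w : (forall Y, lform w (dd g x Y) = 0) ->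
  lform w (npart x z) = lform w z.
Proof. by move=> wT; rewrite lformBr wT subr0. Qed.

Lemma tangent_inj x X Y : U x ->
  (forall Z, lform (dd g x X) (dd g x Z) = lform (dd g x Y) (dd g x Z)) -> X = Y.
Proof.
move=> Ux XY; apply/eqP; rewrite -subr_eq0; apply/negP => /negP /(g_spacelike Ux).
by rewrite {1}(tangentB X Y Ux) lformBl XY subrr ltxx.
Qed.

Lemma tangent_spaceP x w : tangent_space g x w <-> exists X, w = dd g x X.
Proof. by rewrite dd.unlock. Qed.

Lemma oproj_tangent x z : U x -> oproj (tangent_space g x) z = tpart x z.
Proof.
move=> Ux; apply: oproj_eq.
- move=> a b /tangent_spaceP[X ->] /tangent_spaceP[Y ->].
  by apply/tangent_spaceP; exists (X - Y); rewrite tangentB.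
- move=> a /tangent_spaceP[X ->] X0; rewrite (@tangent_inj x X 0) ?tangent0 // => Z.
  by rewrite lform0l; apply: X0; apply/tangent_spaceP; exists Z.
- by apply/tangent_spaceP; exists (tcoef x z).
- by move=> _ /tangent_spaceP[Y ->]; apply: npart_normal.
Qed.

Lemma smooth_on_tcoef w k : smooth_on U w ->
  smooth_on U (fun x => tcoef x (w x) 0 k : R^o).
Proof.
move=> sw; have s j : smooth_on U (fun x => lform (w x) (dd g x (delta_mx 0 j)) * invmx (gram x) j k : R^o).
  apply: smooth_onM => //; first exact: (smooth_on_lform oU sw (sdg (delta_mx 0 j))).
  apply: smooth_on_invmx => // [i l|]; last exact: gram_unit.
  have := smooth_on_lform oU (sdg (delta_mx 0 i)) (sdg (delta_mx 0 l)).
  by apply: smooth_on_eq => // x _; rewrite mxE.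
apply: smooth_on_eq (smooth_on_sum oU (index_enum 'I_n) xpredT s) => // x _.
by rewrite mxE; apply: eq_bigr => j _; rewrite mxE.
Qed.

Lemma smooth_on_tpart w : smooth_on U w -> smooth_on U (fun x => tpart x (w x)).
Proof.
move=> sw; have s i : smooth_on U (fun x => tcoef x (w x) 0 i *: dd g x (delta_mx 0 i)).
  exact: (smooth_on_vZ oU (smooth_on_tcoef i sw) (sdg _)).
apply: smooth_on_eq (smooth_on_vsum oU s) => // x Ux.
exact: tangent_sum.
Qed.

Lemma smooth_on_npart w : smooth_on U w -> smooth_on U (fun x => npart x (w x)).
Proof. by move=> sw; apply: smooth_on_vB => //; apply: smooth_on_tpart. Qed.

(** Weingarten equation. *)
Lemma weingarten xi x X Y : smooth_on U xi ->
  (forall y Z, U y -> lform (xi y) (dd g y Z) = 0) -> U x ->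
  lform (dd xi x X) (dd g x Y) = - lform (xi x) (hess x X Y).
Proof.
move=> sxi xiT Ux; apply/eqP; rewrite -addr_eq0; apply/eqP.
rewrite /hess -(dd_lform _ sxi (sdg Y) Ux).
rewrite (dd_eq_on oU X Ux (h := fun=> 0)) ?dd_cst // => y Uy.
exact: xiT.
Qed.

Lemma npart_eq x z : U x -> (forall Y, lform z (dd g x Y) = 0) -> npart x z = z.
Proof.
move=> Ux zT; rewrite /npart /tpart /tcoef.
rewrite (_ : \row_j lform z (dd g x (delta_mx 0 j)) = 0) ?mul0mx ?tangent0 ?subr0 //.
by apply/rowP => j; rewrite !mxE zT.
Qed.

Lemma normal_subspaceP TQ x v : normal_subspace TQ g x v <->
  TQ (g x) v /\ forall X, lform v (dd g x X) = 0.
Proof. by rewrite dd.unlock. Qed.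

(** If the normal vector [v] extends to a normal field, its shape operator
    represents the second fundamental form in the direction [v]. *)
Lemma shape_operatorP TQ x v A : U x ->
  (normal_subspace TQ g x v -> exists2 xi, normal_field TQ U g xi & xi x = v) ->
  is_shape_operator TQ U g x v A <->
  normal_subspace TQ g x v /\
  forall X Y, lform (dd g x (X *m A)) (dd g x Y) = lform v (hess x X Y).
Proof.
move=> Ux ext; split=> [[xi [[sxi xiN] <- xiA]]|[vN vA]].
  split=> [|X Y]; first exact: xiN.
  have := xiA X; rewrite !ddE oproj_tangent // => ->.
  rewrite lform_tpart // lformNl (weingarten _ _ sxi) ?opprK // => y Z Uy.
  by have /normal_subspaceP[_] := xiN y Uy; apply.
have [xi [sxi xiN] xix] := ext vN; exists xi; split=> // X.
rewrite !ddE oproj_tangent // /tpart; congr (dd _ _ _); apply: (tangent_inj Ux) => Y.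
rewrite -/(tpart x _) lform_tpart // vA lformNl (weingarten _ _ sxi) ?opprK ?xix //.
by move=> y Z Uy; have /normal_subspaceP[_] := xiN y Uy; apply.
Qed.

(** The operator that represents the second fundamental form in the direction
    [v]. *)
Definition shape_mx x v : 'M[R]_n :=
  (\matrix_(i, j) lform v (hess x (delta_mx 0 i) (delta_mx 0 j))) *m invmx (gram x).

(** Bilinearity of the second derivative, in matrix form. *)
Lemma hess_mxE x v X Y : U x -> lform v (hess x X Y) =
  (X *m (\matrix_(i, j) lform v (hess x (delta_mx 0 i) (delta_mx 0 j))) *m Y^T) 0 0.
Proof.
move=> Ux.
have sumr (Z : 'rV[R]_n) (h : 'rV[R]_n -> R) :
    (forall a W W', h (a *: W + W') = a * h W + h W') ->
    h Z = \sum_i Z 0 i * h (delta_mx 0 i).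
  move=> hl; have h0 : h 0 = 0 by have := hl 1 0 0; rewrite scaler0 addr0; lra.
  rewrite {1}(row_sum_delta Z); elim: (index_enum 'I_n) => [|i r IHr].
    by rewrite !big_nil h0.
  by rewrite !big_cons hl IHr.
rewrite (sumr Y (fun Y => lform v (hess x X Y))); last first.
  by move=> a W W'; rewrite hessDr // hessZr // lformR lformZr.
rewrite mxE; apply: eq_bigr => j _; rewrite [in RHS]mxE mulrC; congr (_ * _); last by rewrite mxE.
rewrite (sumr X (fun X => lform v (hess x X _))); last first.
  by move=> a W W'; rewrite hessDl // hessZl // lformR lformZr.
by apply: eq_bigr => i _; rewrite mxE.
Qed.

Lemma shape_mxE x v X Y : U x ->
  lform (dd g x (X *m shape_mx x v)) (dd g x Y) = lform v (hess x X Y).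
Proof.
move=> Ux; rewrite gramE // /shape_mx mulmxA mulmxKV ?gram_unit //.
by rewrite hess_mxE.
Qed.

Lemma shape_mx_eq x v A : U x ->
  (forall X Y, lform (dd g x (X *m A)) (dd g x Y) = lform v (hess x X Y)) ->
  A = shape_mx x v.
Proof.
move=> Ux Av; apply/row_matrixP => i; rewrite !rowE; apply: (tangent_inj Ux) => Z.
by rewrite Av shape_mxE.
Qed.

End Immersed.

(** * The Gauss equation *)

Section Gauss.
Variables (R : realType) (n N : nat) (U : set 'rV[R]_n) (g : 'rV[R]_n -> 'rV[R]_N).
Hypotheses (oU : open U) (sg : smooth_on U g).
Hypothesis g_spacelike : forall x, U x -> forall X, X != 0 ->
  0 < lform (dd g x X) (dd g x X).
(* [h] is a metric on [U] that agrees there with the induced one. *)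
Variable h : 'rV[R]_n -> 'M[R]_n.
Hypothesis hE : forall x, U x -> h x = gram g x.

Local Notation ei := (delta_mx 0).

Let shess X Y : smooth_on U (fun x => hess g x X Y).
Proof. by apply: smooth_on_dd; apply: smooth_on_dd. Qed.

Let sdg X : smooth_on U (fun x => dd g x X).
Proof. exact: smooth_on_dd. Qed.

(** The second fundamental form. *)
Definition sff x X Y : 'rV[R]_N := npart g x (hess g x X Y).

Lemma dd_metric x i j l : U x ->
  pderiv (fun y => h y j l : R^o) i x =
  lform (hess g x (ei i) (ei j)) (dd g x (ei l)) + lform (dd g x (ei j)) (hess g x (ei i) (ei l)).
Proof.
move=> Ux; rewrite /pderiv ddE.
rewrite (dd_eq_on oU (ei i) Ux (h := fun y => lform (dd g y (ei j)) (dd g y (ei l)))).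
  exact: dd_lform.
by move=> y Uy; rewrite hE // mxE.
Qed.

(** The Christoffel symbols are the coordinates of the tangential parts of the
    second derivatives. *)
Lemma christoffelE x k i j : U x ->
  christoffel h k i j x = tcoef g x (hess g x (ei i) (ei j)) 0 k.
Proof.
move=> Ux; rewrite /christoffel mulr_sumr /tcoef mxE; apply: eq_bigr => l _.
rewrite !dd_metric // hE // -[gram g x in LHS](gram_tr g x) -trmx_inv [in LHS]mxE.
rewrite (hessC oU sg (ei j) (ei i)) // (hessC oU sg (ei l) (ei i)) // (hessC oU sg (ei l) (ei j)) //.
rewrite (lformC (dd g x (ei j))) (lformC (dd g x (ei i))) [in RHS]mxE.
by field.
Qed.

Let N_ (j k : 'I_n) y : 'rV[R]_N := sff y (ei j) (ei k).

Let sN j k : smooth_on U (N_ j k).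
Proof. by apply: (smooth_on_npart oU sg g_spacelike). Qed.

(* The [l]-th coordinate of the tangential part of the derivative, in the
   direction [i], of the tangential part of the second derivative [j], [k]. *)
Let coef i j k l x : R := pderiv (christoffel h l j k : _ -> R^o) i x
  + \sum_m christoffel h l i m x * christoffel h m j k x.

(** The tangential part of a third derivative; its normal contribution comes
    from the Weingarten equation. *)
Lemma third_derivative x i j k p : U x ->
  lform (dd (fun y => hess g y (ei j) (ei k)) x (ei i)) (dd g x (ei p)) =
  \sum_l coef i j k l x * lform (dd g x (ei l)) (dd g x (ei p))
  - lform (N_ j k x) (N_ i p x).
Proof.
move=> Ux.
pose T y := \sum_l christoffel h l j k y *: dd g y (ei l).
have sc l : smooth_on U (christoffel h l j k : _ -> R^o).
  have := smooth_on_tcoef oU sg g_spacelike l (shess (ei j) (ei k)).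
  by apply: smooth_on_eq => // y Uy; rewrite christoffelE.
have scT l : smooth_on U (fun y => christoffel h l j k y *: dd g y (ei l)).
  exact: smooth_on_vZ.
have sT : smooth_on U T by exact: smooth_on_vsum.
rewrite (dd_eq_on oU (ei i) Ux (h := fun y => T y + N_ j k y)); last first.
  move=> y Uy; rewrite /N_ /sff /npart (_ : tpart _ _ _ = T y); first by rewrite addrC subrK.
  by rewrite /tpart (tangent_sum sg) //; apply: eq_bigr => l _; rewrite christoffelE.
have NT y Z : U y -> lform (N_ j k y) (dd g y Z) = 0.
  by move=> Uy; apply: (npart_normal sg g_spacelike).
rewrite (ddD (ei i) sT (sN j k) Ux) lformDl.
rewrite (weingarten oU sg (ei i) (ei p) (sN j k) NT Ux).
congr (_ - _); last first.
  by rewrite [N_ i p x]/sff lform_npart // => Y; exact: NT.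
rewrite (dd_sum (ei i) oU scT Ux) lform_suml.
under eq_bigr => l _ do rewrite (dd_vZ _ (sc l) (sdg (ei l)) Ux) lformDl !lformZl.
rewrite big_split [RHS](eq_bigr (fun l => pderiv (christoffel h l j k : _ -> R^o) i x *
      lform (dd g x (ei l)) (dd g x (ei p)) + (\sum_m christoffel h l i m x * christoffel h m j k x) *
      lform (dd g x (ei l)) (dd g x (ei p)))); last by move=> l _; rewrite mulrDl.
rewrite [RHS]big_split /=; congr (_ + _).
  by apply: eq_bigr => l _; rewrite /pderiv ddE.
under [RHS]eq_bigr => l _ do rewrite mulr_suml.
rewrite exchange_big /=; apply: eq_bigr => m _.
rewrite -/(hess g x (ei i) (ei m)) -(lform_tpart sg g_spacelike) // /tpart.
rewrite [X in lform X _](tangent_sum sg) // lform_suml mulr_sumr; apply: eq_bigr => l _.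
by rewrite lformZl -christoffelE // mulrA (mulrC (christoffel h m j k x)).
Qed.

Hypothesis h_flat : flat_metric_on U h.

(** Flatness makes the tangential contributions symmetric. *)
Lemma coef_sym x i j k l : U x -> coef i j k l x = coef j i k l x.
Proof.
move=> Ux; have := h_flat Ux l k i j; rewrite /riemann big_split /= sumrN /coef.
move: (pderiv _ _ _) (pderiv _ _ _) (\sum_m _) (\sum_m _) => a b c d.
lra.
Qed.

Lemma gauss_coord x i j k p : U x -> lform (N_ j k x) (N_ i p x) = lform (N_ i k x) (N_ j p x).
Proof.
move=> Ux; have E := third_derivative i j k p Ux.
rewrite (ddC oU (ei i) (ei j) (sdg (ei k)) Ux) (third_derivative j i k p Ux) in E.
apply/oppr_inj/(addrI (\sum_l coef i j k l x * lform (dd g x (ei l)) (dd g x (ei p)))).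
by rewrite -E (eq_bigr _ (fun l _ => congr1 (fun c => c * _) (coef_sym j i k l Ux))).
Qed.

Lemma sff_linear x a X X' Y : U x -> sff x (a *: X + X') Y = a *: sff x X Y + sff x X' Y.
Proof. by move=> Ux; rewrite /sff (hessDl sg) // (hessZl sg) // (npart_linear sg). Qed.

Lemma sffC x X Y : U x -> sff x X Y = sff x Y X.
Proof. by move=> Ux; rewrite /sff (hessC oU sg). Qed.

(** Gauss equation for an immersion with flat induced metric. *)
Lemma gauss_flat x X Y Z W : U x ->
  lform (sff x X Y) (sff x Z W) = lform (sff x Z Y) (sff x X W).
Proof.
move=> Ux; apply/eqP; rewrite -subr_eq0; apply/eqP.
have lin0 (k : 'rV[R]_n -> R) : (forall a V V', k (a *: V + V') = a * k V + k V') ->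
    (forall i, k (ei i) = 0) -> forall V, k V = 0.
  move=> kl k0 V; have k00 : k 0 = 0 by have := kl 1 0 0; rewrite scaler0 addr0; lra.
  rewrite (row_sum_delta V); elim: (index_enum 'I_n) => [|i r IHr]; first by rewrite big_nil.
  by rewrite big_cons kl IHr k0 mulr0 addr0.
have sl a V V' Y' : sff x Y' (a *: V + V') = a *: sff x Y' V + sff x Y' V'.
  by rewrite sffC // sff_linear // (sffC V) // (sffC V').
move: X; apply: (lin0) => [a V V'|i].
  by rewrite !(sff_linear _ _ _ _ Ux) lform_linearl lform_linearr mulrBr opprD addrACA.
move: Y; apply: (lin0) => [a V V'|j].
  by rewrite !sl !lform_linearl mulrBr opprD addrACA.
move: Z; apply: (lin0) => [a V V'|k].
  by rewrite !(sff_linear _ _ _ _ Ux) lform_linearr lform_linearl mulrBr opprD addrACA.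
move: W; apply: (lin0) => [a V V'|l].
  by rewrite !sl !lform_linearr mulrBr opprD addrACA.
by apply/eqP; rewrite subr_eq0; apply/eqP; exact: gauss_coord.
Qed.

End Gauss.

(** * Normal derivatives *)

Section NormalDerivative.
Variables (R : realType) (n N : nat) (U : set 'rV[R]_n) (g : 'rV[R]_n -> 'rV[R]_N).
Hypotheses (oU : open U) (sg : smooth_on U g).
Hypothesis g_spacelike : forall x, U x -> forall X, X != 0 ->
  0 < lform (dd g x X) (dd g x X).

(** Paired with a normal vector, the derivative of a tangent field only sees
    the derivative of the tangent frame. *)
Lemma dd_tpart_normal w x X eta : smooth_on U w -> U x ->
  (forall Y, lform (dd g x Y) eta = 0) ->
  lform (dd (fun y => tpart g y (w y)) x X) eta =
  lform (hess g x X (tcoef g x (w x))) eta.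
Proof.
move=> sw Ux etaN.
have sc k := smooth_on_tcoef oU sg g_spacelike k sw.
have sdg k : smooth_on U (fun y => dd g y (delta_mx 0 k)) by exact: smooth_on_dd.
have scT k : smooth_on U (fun y => tcoef g y (w y) 0 k *: dd g y (delta_mx 0 k)).
  exact: smooth_on_vZ.
rewrite (dd_eq_on oU X Ux (h := fun y => \sum_k tcoef g y (w y) 0 k *: dd g y (delta_mx 0 k))); last first.
  by move=> y Uy; rewrite /tpart (tangent_sum sg).
rewrite (dd_sum X oU scT Ux) lform_suml.
under eq_bigr => k _ do rewrite (dd_vZ X (sc k) (sdg k) Ux) lformDl !lformZl etaN mulr0 add0r.
rewrite (hessC oU sg) // /hess [in RHS](tangent_sum (smooth_on_dd X sg)) // lform_suml.
apply: eq_bigr => k _; rewrite lformZl; congr (_ * lform _ _).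
exact: (ddC oU).
Qed.

Lemma tangent_inj_basis x X Y : U x ->
  (forall j, lform (dd g x X) (dd g x (delta_mx 0 j)) = lform (dd g x Y) (dd g x (delta_mx 0 j))) -> X = Y.
Proof.
move=> Ux XY; apply: (tangent_inj sg g_spacelike Ux) => Z.
rewrite (tangent_sum sg Z) // !lform_sumr; apply: eq_bigr => j _.
by rewrite !lformZr XY.
Qed.

(** The Ricci symmetry [II_w(X, A_v Y) = II_w(Y, A_v X)] says that [A_v A_w] is
    self-adjoint, that is, that [A_v] and [A_w] commute. *)
Lemma shape_mx_comm_of x v w : U x ->
  (forall i j, lform w (hess g x (delta_mx 0 i) (delta_mx 0 j *m shape_mx g x v)) =
               lform w (hess g x (delta_mx 0 j) (delta_mx 0 i *m shape_mx g x v))) ->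
  shape_mx g x v *m shape_mx g x w = shape_mx g x w *m shape_mx g x v.
Proof.
move=> Ux sym; have E := shape_mxE oU sg g_spacelike.
apply/row_matrixP => i; rewrite !rowE (mulmxA _ (shape_mx g x v)) (mulmxA _ (shape_mx g x w)); apply: (tangent_inj_basis Ux) => j.
rewrite (E x w _ _ Ux) (E x v _ _ Ux) [in LHS](hessC oU sg) // -sym.
rewrite -(E x w (delta_mx 0 i) _ Ux) lformC (E x v _ _ Ux).
by rewrite [in LHS](hessC oU sg).
Qed.

End NormalDerivative.

(** * Immersions into the sphere *)

Section Sphere.
Variables (R : realType) (n N : nat) (U : set 'rV[R]_n) (t0 : 'rV[R]_N).
Variable f : 'rV[R]_n -> 'rV[R]_N.
Hypotheses (oU : open U) (sf : smooth_on U f) (t0t0 : lform t0 t0 = -1).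
Hypotheses (ft0 : forall x, U x -> lform (f x) t0 = 0)
           (ff : forall x, U x -> lform (f x) (f x) = 1).
Hypothesis f_inj : forall x, U x -> forall X, dd f x X = 0 -> X = 0.

Lemma dd_orth (xi eta : 'rV[R]_n -> 'rV[R]_N) x X : smooth_on U xi -> smooth_on U eta -> U x ->
  (forall y, U y -> lform (xi y) (eta y) = 0) ->
  lform (dd xi x X) (eta x) = - lform (xi x) (dd eta x X).
Proof.
move=> sxi seta Ux xe; apply/eqP; rewrite -addr_eq0 -(dd_lform X sxi seta Ux).
by rewrite (dd_eq_on oU X Ux (h := fun=> 0)) ?dd_cst.
Qed.

Lemma dd_orth_cst (xi : 'rV[R]_n -> 'rV[R]_N) w x X : smooth_on U xi -> U x ->
  (forall y, U y -> lform (xi y) w = 0) -> lform (dd xi x X) w = 0.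
Proof.
move=> sxi Ux xe; have := dd_orth X sxi (smooth_on_vcst oU w) Ux xe.
by rewrite dd_cst lform0r oppr0.
Qed.

Lemma tangent_t0 x X : U x -> lform (dd f x X) t0 = 0.
Proof. by move=> Ux; apply: dd_orth_cst. Qed.

Lemma tangent_f x X : U x -> lform (dd f x X) (f x) = 0.
Proof.
move=> Ux; have := dd_lform X sf sf Ux.
rewrite (dd_eq_on oU X Ux (h := fun=> 1 : R^o)) // dd_cst [lform (f x) _]lformC.
lra.
Qed.

Lemma f_spacelike x : U x -> forall X, X != 0 -> 0 < lform (dd f x X) (dd f x X).
Proof.
move=> Ux X Xn0; apply: (lform_spacelike t0t0); first exact: tangent_t0.
by apply: contra Xn0 => /eqP/(f_inj Ux)->.
Qed.

Local Notation Nf := (normal_subspace (T_sphere t0) f).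

Lemma sphere_normalP x v : Nf x v <->
  [/\ lform v t0 = 0, lform v (f x) = 0 & forall X, lform v (dd f x X) = 0].
Proof. by rewrite normal_subspaceP /T_sphere /=; split=> [[[]]|[]]. Qed.

(** The projection onto the normal space of [f] in the sphere: remove the
    components along [t0] and [f x], then the tangential part.  As [t0] is
    timelike, its component is [- (z, t0)]. *)
Definition sphere_proj x z :=
  npart f x (z + lform z t0 *: t0 - lform z (f x) *: f x).

Lemma npart_orth x z w : (forall X, lform (dd f x X) w = 0) ->
  lform (npart f x z) w = lform z w.
Proof. by move=> Tw; rewrite lformC lform_npart 1?lformC // => Y; rewrite lformC. Qed.

Lemma sphere_projP x z : U x -> Nf x (sphere_proj x z).
Proof.
move=> Ux; apply/sphere_normalP; split.
- rewrite npart_orth // => [|X]; last exact: tangent_t0.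
  by rewrite !lformL t0t0 ft0 //; ring.
- rewrite npart_orth // => [|X]; last exact: tangent_f.
  by rewrite !lformL ff // [lform t0 _]lformC ft0 //; ring.
- by move=> X; apply: (npart_normal sf f_spacelike).
Qed.

Lemma lform_sphere_proj x z w : Nf x w -> lform (sphere_proj x z) w = lform z w.
Proof.
move=> /sphere_normalP[wt wf wT]; rewrite npart_orth // => [|X]; last by rewrite lformC.
by rewrite !lformL [lform t0 _]lformC wt [lform (f x) _]lformC wf; ring.
Qed.

Lemma sphere_normal_nondeg x v : Nf x v -> (forall w, Nf x w -> lform v w = 0) -> v = 0.
Proof.
move=> Nv v0; apply/eqP/negPn/negP => vn0; have := v0 v Nv.
have /sphere_normalP[vt _ _] := Nv.
by have := lform_spacelike t0t0 vt vn0; lra.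
Qed.

Lemma sphere_normalB x v w : Nf x v -> Nf x w -> Nf x (v - w).
Proof.
move=> /sphere_normalP[vt vf vT] /sphere_normalP[wt wf wT]; apply/sphere_normalP.
by split=> [||X]; rewrite lformBl ?vt ?wt ?vf ?wf ?vT ?wT subrr.
Qed.

Lemma oproj_sphere x z : U x -> oproj (Nf x) z = sphere_proj x z.
Proof.
move=> Ux; apply: oproj_eq.
- exact: sphere_normalB.
- by move=> a; apply: sphere_normal_nondeg.
- exact: sphere_projP.
- by move=> w Nw; rewrite lformBl lform_sphere_proj // subrr.
Qed.

(** The vector [v] is extended by its projections onto the normal spaces. *)
Lemma sphere_normal_extension x v : U x -> Nf x v ->
  exists2 xi, normal_field (T_sphere t0) U f xi & xi x = v.
Proof.
move=> Ux /sphere_normalP[vt vf vT].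
pose w y := v - lform v (f y) *: f y.
have sw : smooth_on U w.
  apply: (smooth_on_vB oU); first exact: smooth_on_vcst.
  apply: (smooth_on_vZ oU) => //; apply: smooth_on_lform => //; exact: smooth_on_vcst.
exists (fun y => npart f y (w y)).
  split; first exact: (smooth_on_npart oU sf f_spacelike).
  move=> y Uy; apply/sphere_normalP; split.
  - rewrite npart_orth // => [|X]; last exact: tangent_t0.
    by rewrite !lformL vt ft0 //; ring.
  - rewrite npart_orth // => [|X]; last exact: tangent_f.
    by rewrite !lformL ff //; ring.
  - by move=> X; apply: (npart_normal sf f_spacelike).
have wx : w x = v by rewrite /w vf scale0r subr0.
by rewrite (npart_eq sf) // wx.
Qed.

(** The derivative of a normal field [xi] of [f] in the sphere is orthogonal to
    [t0] and to [f], because [(xi, D_X f) = 0]; only its tangential part has to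
    be removed. *)
Lemma normal_conn_sphere xi i y : normal_field (T_sphere t0) U f xi -> U y ->
  normal_conn (T_sphere t0) f i xi y = npart f y (dd xi y (delta_mx 0 i)).
Proof.
move=> [sxi xiN] Uy; rewrite /normal_conn oproj_sphere // /pderiv ddE /sphere_proj.
have /sphere_normalP[_ _ xiT] := xiN y Uy.
have -> : lform (dd xi y (delta_mx 0 i)) t0 = 0.
  by apply: dd_orth_cst => // z Uz; have /sphere_normalP[] := xiN z Uz.
have -> : lform (dd xi y (delta_mx 0 i)) (f y) = 0.
  rewrite dd_orth // ?xiT ?oppr0 // => z Uz.
  by have /sphere_normalP[] := xiN z Uz.
by rewrite !scale0r addr0 subr0.
Qed.

(** Ricci equation: when the normal bundle is flat, shape operators commute. *)
Lemma ricci x v w : flat_normal_conn (T_sphere t0) U f -> U x -> Nf x v -> Nf x w ->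
  shape_mx f x v *m shape_mx f x w = shape_mx f x w *m shape_mx f x v.
Proof.
move=> flat Ux Nv Nw; apply: (shape_mx_comm_of oU sf f_spacelike Ux).
have [xi xiN xix] := sphere_normal_extension Ux Nv.
have [sxi xiNy] := xiN.
have xiT y Z : U y -> lform (xi y) (dd f y Z) = 0.
  by move=> Uy; have /sphere_normalP[] := xiNy y Uy.
have /sphere_normalP[_ _ wT] := Nw.
have C i : tcoef f x (dd xi x (delta_mx 0 i)) = - (delta_mx 0 i *m shape_mx f x v).
  apply: (tangent_inj sf f_spacelike Ux) => Z.
  rewrite -[dd f x (tcoef _ _ _)]/(tpart f x _) (lform_tpart sf f_spacelike) //.
  rewrite (weingarten oU sf _ _ sxi xiT) // xix (tangentN sf) // lformNl.
  by rewrite (shape_mxE oU sf f_spacelike).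
have key i j : lform (normal_conn (T_sphere t0) f i (normal_conn (T_sphere t0) f j xi) x) w =
    lform (dd (fun y => dd xi y (delta_mx 0 j)) x (delta_mx 0 i)) w
    + lform w (hess f x (delta_mx 0 i) (delta_mx 0 j *m shape_mx f x v)).
  have sdxi : smooth_on U (fun y => dd xi y (delta_mx 0 j)) by exact: smooth_on_dd.
  rewrite [normal_conn _ _ i]/normal_conn oproj_sphere // lform_sphere_proj // /pderiv ddE.
  rewrite (dd_eq_on oU _ Ux (fun y => normal_conn_sphere j xiN)).
  rewrite /npart (ddB _ sdxi (smooth_on_tpart oU sf f_spacelike sdxi)) // lformBl.
  rewrite (dd_tpart_normal oU sf f_spacelike _ sdxi) // => [|Y]; last by rewrite lformC.
  congr (_ + _); rewrite C (hessNr oU sf) // lformNl opprK.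
  exact: lformC.
move=> i j; have E := congr1 (fun z => lform z w) (flat xi xiN x Ux i j).
have := etrans (esym (key i j)) (etrans E (key j i)).
rewrite (ddC oU (delta_mx 0 i) (delta_mx 0 j) sxi Ux).
exact: addrI.
Qed.

End Sphere.

(** * Curvature directions as common eigenvectors *)

Section CurvatureDirections.
Variables (R : realType) (n N : nat) (TQ : 'rV[R]_N -> set 'rV[R]_N).
Variables (U : set 'rV[R]_n) (g : 'rV[R]_n -> 'rV[R]_N) (x : 'rV[R]_n).
Hypothesis shapeP : forall v A, is_shape_operator TQ U g x v A <->
  normal_subspace TQ g x v /\ A = shape_mx g x v.
Local Notation Nx := (normal_subspace TQ g x).

(** [X] is a common eigenvector of the shape operators at [x]. *)
Definition shape_eigenvector (X : 'rV[R]_n) :=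
  forall v, Nx v -> exists lambda, X *m shape_mx g x v = lambda *: X.

Lemma curvature_directionP (X : 'rV[R]_n) : is_curvature_direction TQ U g x X <->
  X != 0 /\ shape_eigenvector X.
Proof.
split=> [[X0 [E [_ [lambda EP] EX]]]|[X0 ev]].
  split=> // v Nv; exists (lambda v); have := (EP X).1 EX; apply.
  by apply/shapeP.
split=> //.
have /choice[lambda lambdaP] : forall v, exists l, Nx v -> X *m shape_mx g x v = l *: X.
  by move=> v; have [/ev[l lP]|Nv] := pselect (Nx v); [exists l | exists 0].
pose E := [set Y : 'rV[R]_n | forall v A, is_shape_operator TQ U g x v A -> Y *m A = lambda v *: Y].
have EX : E X by move=> v A /shapeP[Nv ->]; apply: lambdaP.
by exists E => //; split; [exists X | exists lambda].
Qed.

Lemma curvature_normalP E v : is_curvature_normal TQ U g x E v ->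
  [/\ Nx v, exists2 X, E X & X != 0 &
   forall X w, E X -> Nx w -> X *m shape_mx g x w = lform w v *: X].
Proof.
move=> [[[X EX X0] _] Nv EP]; split=> //; first by exists X.
by move=> Y w EY Nw; apply: EP EY; apply/shapeP.
Qed.

(** The eigenspace is the set of all vectors on which each shape operator is
    multiplication by its product with [v]. *)
Lemma is_curvature_normal_of (X : 'rV[R]_n) v : Nx v -> X != 0 ->
  (forall w, Nx w -> X *m shape_mx g x w = lform w v *: X) ->
  is_curvature_normal TQ U g x
    [set Y : 'rV[R]_n | forall w, Nx w -> Y *m shape_mx g x w = lform w v *: Y] v.
Proof.
move=> Nv X0 Xv; split=> //.
  split; first by exists X.
  exists (fun w => lform w v) => Y; split=> [EY w A /shapeP[Nw ->]|EY w Nw]; first exact: EY.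
  by apply: EY; apply/shapeP.
by move=> w A /shapeP[Nw ->] Y; apply.
Qed.

End CurvatureDirections.

Section ShapeLinear.
Variables (R : realType) (n N : nat) (g : 'rV[R]_n -> 'rV[R]_N) (x : 'rV[R]_n).

Lemma shape_mx_linear a v w :
  shape_mx g x (a *: v + w) = a *: shape_mx g x v + shape_mx g x w.
Proof.
rewrite /shape_mx scalemxAl -mulmxDl; congr (_ *m _); apply/matrixP => i j.
by rewrite !mxE lformDl lformZl.
Qed.

Lemma shape_mx0 : shape_mx g x 0 = 0.
Proof.
by have := shape_mx_linear (-1) 0 0; rewrite scaler0 addr0 scaleN1r addNr.
Qed.

Lemma shape_mxD v w : shape_mx g x (v + w) = shape_mx g x v + shape_mx g x w.
Proof. by rewrite -[v]scale1r shape_mx_linear !scale1r. Qed.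

Lemma shape_mxZ a v : shape_mx g x (a *: v) = a *: shape_mx g x v.
Proof. by rewrite -[a *: v]addr0 shape_mx_linear shape_mx0 addr0. Qed.

Lemma shape_mx_sum (I : Type) (r : seq I) (P : pred I) (v : I -> 'rV[R]_N) :
  shape_mx g x (\sum_(i <- r | P i) v i) = \sum_(i <- r | P i) shape_mx g x (v i).
Proof.
by apply: (big_morph (shape_mx g x)); [exact: shape_mxD | exact: shape_mx0].
Qed.

End ShapeLinear.

Lemma shape_operator_mxP (R : realType) (n N : nat) (U : set 'rV[R]_n)
    (g : 'rV[R]_n -> 'rV[R]_N) TQ x v A :
  open U -> smooth_on U g ->
  (forall x, U x -> forall X, X != 0 -> 0 < lform (dd g x X) (dd g x X)) -> U x ->
  (normal_subspace TQ g x v -> exists2 xi, normal_field TQ U g xi & xi x = v) ->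
  is_shape_operator TQ U g x v A <-> normal_subspace TQ g x v /\ A = shape_mx g x v.
Proof.
move=> oU sg pos Ux ext; rewrite (shape_operatorP oU sg pos _ Ux ext).
split=> -[Nv]; first by move=> /(shape_mx_eq oU sg pos Ux) ->.
by move=> ->; split=> // X Y; rewrite (shape_mxE oU sg pos).
Qed.

Lemma exists_orthogonal2 (F : fieldType) n (a b : 'cV[F]_n) : (2 < n)%N ->
  exists Z : 'rV[F]_n, [/\ Z != 0, Z *m a = 0 & Z *m b = 0].
Proof.
move=> n3; have : kermx (row_mx a b) != 0.
  rewrite -mxrank_eq0 mxrank_ker subn_eq0 -ltnNge.
  by apply: leq_ltn_trans (rank_leq_col _) _; rewrite addn1.
move=> /rowV0Pn[Z /sub_kermxP]; rewrite mul_mx_row => ZE Z0; exists Z.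
have : row_mx (Z *m a) (Z *m b) = row_mx 0 0 by rewrite ZE row_mx0.
by move=> /eq_row_mx[].
Qed.

(** * The flat lift *)

Section Lift.
Variables (R : realType) (n N : nat) (U : set 'rV[R]_n) (t0 : 'rV[R]_N).
Hypothesis n_ge3 : (2 < n)%N.
Variables (f F : 'rV[R]_n -> 'rV[R]_N) (u : 'rV[R]_n -> R^o).
Hypotheses (oU : open U) (sf : smooth_on U f) (t0t0 : lform t0 t0 = -1).
Hypotheses (ft0 : forall x, U x -> lform (f x) t0 = 0)
           (ff : forall x, U x -> lform (f x) (f x) = 1).
Hypothesis f_inj : forall x, U x -> forall X, dd f x X = 0 -> X = 0.
Hypotheses (su : smooth_on U u) (FE : forall x, U x -> F x = - (expR (u x) *: (f x + t0))).
Hypothesis flat : flat_metric_on U (fun x => expR (2 * u x) *: induced_metric f x).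

Local Notation Nf := (normal_subspace (T_sphere t0) f).
Local Notation NF := (normal_subspace (@T_lorentz R N) F).
Local Notation Ne := (normal_subspace (T_euclid t0) f).
Local Notation r x := (expR (u x)).

Let f_pos := f_spacelike oU sf t0t0 ft0 f_inj.
Let f_t0 := tangent_t0 oU sf ft0.
Let f_f := tangent_f oU sf ff.

Let sE : smooth_on U (fun x => - expR (u x) : R^o).
Proof.
by apply: smooth_on_eq (smooth_onM oU (smooth_on_cst oU (-1)) (smooth_on_exp oU su)) => // x _; rewrite mulN1r.
Qed.

Let sft : smooth_on U (fun x => f x + t0).
Proof. by apply: (smooth_on_vD oU) => //; exact: smooth_on_vcst. Qed.

Let FE' x : U x -> F x = (- r x) *: (f x + t0).
Proof. by move=> Ux; rewrite FE // scaleNr. Qed.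

Lemma lift_smooth : smooth_on U F.
Proof. by apply: smooth_on_eq (smooth_on_vZ oU sE sft) => // x Ux; rewrite FE'. Qed.
Let sF := lift_smooth.

Lemma dd_lift x X : U x -> dd F x X = - r x *: (dd f x X + dd u x X *: (f x + t0)).
Proof.
move=> Ux; rewrite (dd_eq_on oU X Ux FE') (dd_vZ X sE sft Ux).
rewrite (ddD X sf (smooth_on_vcst oU t0) Ux) dd_cst addr0.
have -> : dd (fun y => - expR (u y) : R^o) x X = - r x * dd u x X.
  by rewrite (ddN X (smooth_on_exp oU su) Ux) (dd_exp X su Ux) mulNr.
by rewrite -scalerA -scalerDr addrC.
Qed.

Lemma null_null x : U x -> lform (f x + t0) (f x + t0) = 0.
Proof. by move=> Ux; rewrite !lformL !lformR ff // t0t0 [lform t0 _]lformC ft0 //; ring. Qed.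

Lemma null_tangent x X : U x -> lform (dd f x X) (f x + t0) = 0.
Proof. by move=> Ux; rewrite lformDr f_t0 // f_f // addr0. Qed.

Lemma lift_metric x X Y : U x ->
  lform (dd F x X) (dd F x Y) = r x ^+ 2 * lform (dd f x X) (dd f x Y).
Proof.
move=> Ux; rewrite !dd_lift //; move: (null_tangent X Ux) (null_tangent Y Ux) (null_null Ux).
move: (f x + t0) => p pX pY pp; rewrite !lformL !lformR [lform p (dd f x Y)]lformC pX pY pp.
by ring.
Qed.

Lemma lift_spacelike x : U x -> forall X, X != 0 -> 0 < lform (dd F x X) (dd F x X).
Proof. by move=> Ux X X0; rewrite lift_metric // mulr_gt0 ?exprn_gt0 ?expR_gt0 // f_pos. Qed.
Let F_pos := lift_spacelike.

Lemma lift_null x : U x -> lform (F x) (F x) = 0.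
Proof. by move=> Ux; rewrite FE' // lformZl lformZr null_null // !mulr0. Qed.

Lemma lift_tangent x X : U x -> lform (F x) (dd F x X) = 0.
Proof.
move=> Ux; have := dd_orth oU X sF sF Ux lift_null; rewrite [lform (dd _ _ _) _]lformC; lra.
Qed.

Lemma lift_hess x X Y : U x -> lform (F x) (hess F x X Y) = - lform (dd F x X) (dd F x Y).
Proof.
move=> Ux; rewrite (dd_orth oU X sF (smooth_on_dd Y sF) Ux) ?opprK // => y Uy.
exact: lift_tangent.
Qed.

Lemma lift_normalP x v : NF x v <-> forall X, lform v (dd F x X) = 0.
Proof. by rewrite normal_subspaceP; split=> [[]|]. Qed.

Lemma lift_normal_self x : U x -> NF x (F x).
Proof. by move=> Ux; apply/lift_normalP => X; exact: lift_tangent. Qed.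

(** A normal vector of [f] in the sphere is normal to the lift. *)
Lemma sphere_normal_lift x w : U x -> Nf x w -> NF x w.
Proof.
move=> Ux /sphere_normalP[wt wf wT]; apply/lift_normalP => X.
by rewrite dd_lift // !lformR wT wt wf; ring.
Qed.

Lemma sphere_normal_hess x w X Y : U x -> Nf x w ->
  lform w (hess F x X Y) = - r x * lform w (hess f x X Y).
Proof.
move=> Ux Nw.
have [xi [sxi xiN] <-] := sphere_normal_extension oU sf t0t0 ft0 ff f_inj Ux Nw.
have xif y Z : U y -> lform (xi y) (dd f y Z) = 0.
  by move=> Uy; have /sphere_normalP[] := xiN y Uy.
have xiF y Z : U y -> lform (xi y) (dd F y Z) = 0.
  by move=> Uy; have /lift_normalP := sphere_normal_lift Uy (xiN y Uy); apply.
have E := weingarten oU sF X Y sxi xiF Ux; have E' := weingarten oU sf X Y sxi xif Ux.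
have xt : lform (dd xi x X) t0 = 0.
  by apply: (dd_orth_cst oU) => // z Uz; have /sphere_normalP[] := xiN z Uz.
have xf : lform (dd xi x X) (f x) = 0.
  rewrite (dd_orth oU) // ?xif ?oppr0 // => z Uz.
  by have /sphere_normalP[] := xiN z Uz.
apply: oppr_inj; rewrite -E dd_lift // !lformR xt xf E'; ring.
Qed.

Lemma shape_lift_sphere x w : U x -> Nf x w ->
  shape_mx F x w = - (r x)^-1 *: shape_mx f x w.
Proof.
move=> Ux Nw; apply/esym/(shape_mx_eq oU sF F_pos Ux) => X Y.
rewrite -scalemxAr (tangentZ sF) // lformZl lift_metric // (shape_mxE oU sf f_pos) //.
by rewrite sphere_normal_hess //; field; rewrite gt_eqF ?expR_gt0.
Qed.

Lemma shape_lift_self x : U x -> shape_mx F x (F x) = - 1%:M.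
Proof.
move=> Ux; apply/esym/(shape_mx_eq oU sF F_pos Ux) => X Y.
by rewrite mulmxN mulmx1 (tangentN sF) // lformNl lift_hess.
Qed.

Lemma lift_shapeP x v A : U x ->
  is_shape_operator (@T_lorentz R N) U F x v A <-> NF x v /\ A = shape_mx F x v.
Proof.
move=> Ux; apply: shape_operator_mxP => // /lift_normalP vN.
exists (fun y => npart F y v); last by rewrite (npart_eq sF).
split; first by apply: (smooth_on_npart oU sF F_pos); exact: smooth_on_vcst.
by move=> y Uy; apply/lift_normalP => X; exact: (npart_normal sF F_pos).
Qed.

Lemma sphere_shape_mxP x v A : U x ->
  is_shape_operator (T_sphere t0) U f x v A <-> Nf x v /\ A = shape_mx f x v.
Proof.
move=> Ux; apply: shape_operator_mxP => // Nv.
exact: (sphere_normal_extension oU sf t0t0 ft0 ff f_inj).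
Qed.

Lemma euclid_normalP x v : Ne x v <-> lform v t0 = 0 /\ forall X, lform v (dd f x X) = 0.
Proof. exact: normal_subspaceP. Qed.

Lemma euclid_shapeP x v A : U x ->
  is_shape_operator (T_euclid t0) U f x v A <-> Ne x v /\ A = shape_mx f x v.
Proof.
move=> Ux; apply: shape_operator_mxP => // /euclid_normalP[vt vN].
exists (fun y => npart f y v); last by rewrite (npart_eq sf).
split; first by apply: (smooth_on_npart oU sf f_pos); exact: smooth_on_vcst.
move=> y Uy; apply/euclid_normalP; split=> [|X]; last exact: (npart_normal sf f_pos).
by rewrite npart_orth // => X; exact: f_t0.
Qed.

(** Gauss equation of the flat lift. *)
Lemma lift_gauss x X Y Z W : U x ->
  lform (sff F x X Y) (sff F x Z W) = lform (sff F x Z Y) (sff F x X W).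
Proof.
apply: (gauss_flat oU sF F_pos _ flat) => y Uy; rewrite induced_metric_gram.
apply/matrixP => i j; rewrite !mxE lift_metric //; congr (_ * _).
by rewrite expr2 -expRD mulr2n mulrDl mul1r.
Qed.

(** In the orthogonal complement of the null vector [f x + t0] only the
    multiples of that vector are null. *)
Lemma null_orth x z : U x -> lform z (f x + t0) = 0 -> lform z z = 0 ->
  z = lform z (f x) *: (f x + t0).
Proof.
move=> Ux zp zz; set a := lform z (f x); set y := z - a *: (f x + t0).
have zt : lform z t0 = - a by apply/eqP; rewrite -addr_eq0 addrC -lformDr zp.
have yt : lform y t0 = 0 by rewrite /y !lformL zt ft0 // t0t0; ring.
have yy : lform y y = 0.
  by rewrite /y lformBl !lformBr !lformZl !lformZr zz [lform (f x + t0) z]lformC zp null_null //; ring.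
apply/eqP; rewrite -subr_eq0 -/y; apply/negPn/negP => y0.
by have := lform_spacelike t0t0 yt y0; rewrite yy ltxx.
Qed.

Lemma lift_null_orth x z : U x -> lform z (F x) = 0 -> lform z (f x + t0) = 0.
Proof.
move=> Ux; rewrite FE' // lformZr => /eqP; rewrite mulf_eq0 oppr_eq0.
by rewrite gt_eqF ?expR_gt0 //= => /eqP.
Qed.

Lemma sff_lift_normal x X Y : U x -> NF x (sff F x X Y).
Proof. by move=> Ux; apply/lift_normalP => Z; exact: (npart_normal sF F_pos). Qed.

Lemma lform_sff x v X Y : NF x v -> lform v (sff F x X Y) = lform v (hess F x X Y).
Proof. by move=> /lift_normalP Nv; rewrite /sff lform_npart. Qed.

(** A normal vector of the lift orthogonal to [F x] and to the normal space of
    [f] in the sphere is a multiple of [F x]. *)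
Lemma normal_multiple_of_lift x z : U x -> NF x z -> lform z (F x) = 0 ->
  (forall w, Nf x w -> lform w z = 0) -> exists c, z = c *: F x.
Proof.
move=> Ux /lift_normalP zN zF zw; have zp := lift_null_orth Ux zF.
suff zz : lform z z = 0.
  exists (- (r x)^-1 * lform z (f x)); rewrite {1}(null_orth Ux zp zz) FE' // scalerA.
  by congr (_ *: _); field; rewrite gt_eqF ?expR_gt0.
set a := lform z (f x); pose y := z - a *: (f x + t0).
have zt : lform z t0 = - a by apply/eqP; rewrite -addr_eq0 addrC -lformDr zp.
have zT X : lform z (dd f x X) = 0.
  have := zN X; rewrite dd_lift // lformZr lformDr lformZr zp mulr0 addr0 => /eqP.
  by rewrite mulf_eq0 oppr_eq0 gt_eqF ?expR_gt0 //= => /eqP.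
have Ny : Nf x y.
  apply/sphere_normalP; split.
  - by rewrite /y !lformL zt ft0 // t0t0; ring.
  - by rewrite /y !lformL ff // [lform t0 _]lformC ft0 // -/a; ring.
  - by move=> X; rewrite /y lformBl lformZl zT [lform (f x + t0) _]lformC null_tangent //; ring.
by have := zw y Ny; rewrite /y lformBl lformZl [lform (f x + t0) z]lformC zp; lra.
Qed.

(** The key step: a principal direction of [f] is conjugate, for the lift, to
    every direction orthogonal to it. *)
Lemma sff_lift_conjugate (x X Y : 'rV[R]_n) : U x -> shape_eigenvector (T_sphere t0) f x X ->
  lform (dd f x X) (dd f x Y) = 0 -> sff F x X Y = 0.
Proof.
move=> Ux evX XY.
have multiple Z : lform (dd f x X) (dd f x Z) = 0 -> exists c, sff F x X Z = c *: F x.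
  move=> XZ; apply: normal_multiple_of_lift => //; first exact: sff_lift_normal.
    rewrite lformC lform_sff; last exact: lift_normal_self.
    by rewrite lift_hess // lift_metric // XZ mulr0 oppr0.
  move=> w Nw; rewrite lform_sff; last exact: sphere_normal_lift.
  have [l Xl] := evX w Nw; rewrite sphere_normal_hess // -(shape_mxE oU sf f_pos) // Xl.
  by rewrite (tangentZ sf) // lformZl XZ !mulr0.
have [Z [Z0 ZX ZY]] := exists_orthogonal2 (gram f x *m X^T) (gram f x *m Y^T) n_ge3.
have ZX' : lform (dd f x X) (dd f x Z) = 0.
  by rewrite lformC (gramE sf) // -mulmxA ZX mxE.
have ZY' : lform (dd f x Z) (dd f x Y) = 0 by rewrite (gramE sf) // -mulmxA ZY mxE.
have [c cE] := multiple Z ZX'; have [d dE] := multiple Y XY.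
have := lift_gauss X Z Z Y Ux; rewrite cE dE lformZl lformZr.
rewrite lform_sff; last exact: lift_normal_self.
rewrite [lform (sff _ _ _ _) _]lformC lform_sff; last exact: lift_normal_self.
rewrite !lift_hess // [X in c * - X]lift_metric // ZY' mulr0 oppr0 mulr0 => /esym/eqP.
rewrite mulf_eq0 oppr_eq0 [X in _ || X]gt_eqF ?F_pos // orbF => /eqP d0.
by rewrite d0 scale0r.
Qed.

(** Hence it is a principal direction of the lift. *)
Lemma sphere_eigenvector_lift (x X : 'rV[R]_n) v : U x -> X != 0 ->
  shape_eigenvector (T_sphere t0) f x X -> NF x v ->
  X *m shape_mx F x v =
  (lform v (sff F x X X) / lform (dd F x X) (dd F x X)) *: X.
Proof.
move=> Ux X0 evX Nv; apply: (tangent_inj sF F_pos Ux) => Z.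
have XX0 : lform (dd F x X) (dd F x X) != 0 by rewrite gt_eqF ?F_pos.
rewrite (shape_mxE oU sF F_pos) // (tangentZ sF) // lformZl -lform_sff //.
set q := lform (dd F x X) (dd F x X) in XX0 *.
pose b := lform (dd F x X) (dd F x Z) / q; pose Y := Z - b *: X.
have XY : lform (dd f x X) (dd f x Y) = 0.
  have : lform (dd F x X) (dd F x Y) = 0.
    rewrite /Y (tangentB sF) // (tangentZ sF) // lformBr lformZr -/q /b; by field.
  rewrite lift_metric // => /eqP; rewrite mulf_eq0 expf_eq0 /= gt_eqF ?expR_gt0 //.
  by move=> /eqP.
have ZE : Z = b *: X + Y by rewrite /Y addrC subrK.
have -> : sff F x X Z = b *: sff F x X X.
  rewrite ZE [LHS](sffC oU sF) // (sff_linear sF) // [sff F x Y X](sffC oU sF) //.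
  by rewrite (sff_lift_conjugate Ux evX XY) addr0.
by rewrite lformZr /b; field.
Qed.

Lemma lift_eigenvector_sphere (x X : 'rV[R]_n) : U x ->
  shape_eigenvector (@T_lorentz R N) F x X -> shape_eigenvector (T_sphere t0) f x X.
Proof.
move=> Ux ev w Nw; have [l] := ev w (sphere_normal_lift Ux Nw).
rewrite shape_lift_sphere // -scalemxAr => E; exists (- r x * l).
by rewrite -scalerA -E scalerA mulrNN divff ?scale1r // gt_eqF ?expR_gt0.
Qed.

Lemma lift_curvature_direction (x X : 'rV[R]_n) : U x ->
  is_curvature_direction (@T_lorentz R N) U F x X <->
  is_curvature_direction (T_sphere t0) U f x X.
Proof.
move=> Ux; rewrite (curvature_directionP (fun v A => lift_shapeP v A Ux)).
rewrite (curvature_directionP (fun v A => sphere_shape_mxP v A Ux)).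
split=> -[X0 ev]; (split; first exact: X0); first exact: lift_eigenvector_sphere.
by move=> v Nv; eexists; exact: (sphere_eigenvector_lift Ux X0 ev Nv).
Qed.

(** All curvature normals of the lift have product [-1] with [F]. *)
Lemma lift_curvature_normal (x X : 'rV[R]_n) v : U x -> X != 0 ->
  (forall w, NF x w -> X *m shape_mx F x w = lform w v *: X) -> lform (F x) v = -1.
Proof.
move=> Ux X0 Xv; have := Xv _ (lift_normal_self Ux).
rewrite shape_lift_self // mulmxN mulmx1 -scaleN1r => /eqP.
by rewrite -subr_eq0 -scalerBl scaler_eq0 (negPf X0) orbF subr_eq0 => /eqP.
Qed.

Lemma lift_curvature_normal_neq0 x E v : U x ->
  is_curvature_normal (@T_lorentz R N) U F x E v -> v != 0.
Proof.
move=> Ux /(curvature_normalP (fun v A => lift_shapeP v A Ux))[Nv [X EX X0] Xv].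
have : lform (F x) v = -1.
  by apply: (lift_curvature_normal Ux X0) => w; exact: Xv.
by apply: contra_eqN => /eqP ->; rewrite lform0r eq_sym oppr_eq0 oner_eq0.
Qed.

(** Both unit vectors span the same direction and the metrics differ by the
    factor [e^(2u)], so that [k = e^u]. *)
Lemma unit_tangent_lift (x X : 'rV[R]_n) k e et : U x ->
  e = dd F x X -> lform e e = 1 -> 0 < k -> et = dd f x (k *: X) -> lform et et = 1 ->
  et = - e + (expR (- u x) * lform e t0) *: F x.
Proof.
move=> Ux -> ee k0 ->; rewrite (tangentZ sf) // lformZl lformZr => ekk.
have r0 : 0 < r x by exact: expR_gt0.
have kr : k = r x.
  move: ee; rewrite lift_metric // => ee.
  have q0 : lform (dd f x X) (dd f x X) != 0.
    by apply/eqP => q0; move: ee; rewrite q0 mulr0 => /eqP; rewrite eq_sym oner_eq0.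
  apply/eqP; rewrite -(@eqrXn2 _ 2) // ?ltW //; apply/eqP/(mulIf q0).
  by rewrite ee expr2 -mulrA.
rewrite expRN dd_lift // FE' // lformZl lformDl lformZl lformDl f_t0 // ft0 // t0t0 kr.
have -> : (r x)^-1 * (- r x * (0 + dd u x X * (0 - 1))) = dd u x X.
  by field; rewrite gt_eqF.
rewrite scalerA scaleNr opprK scalerDr -addrA scalerA -scalerDl mulrN (mulrC (dd u x X)).
by rewrite subrr scale0r addr0.
Qed.

(** Both sides lie in the normal space of [f] in the sphere and have the same
    products with it. *)
Lemma lift_sphere_curvature_normal (x X : 'rV[R]_n) v vS : U x -> X != 0 -> Nf x vS ->
  (forall w, NF x w -> X *m shape_mx F x w = lform w v *: X) ->
  (forall w, Nf x w -> X *m shape_mx f x w = lform w vS *: X) ->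
  vS = - (r x *: oproj (Nf x) v).
Proof.
move=> Ux X0 NvS Xv XvS; rewrite (oproj_sphere oU sf t0t0 ft0 ff f_inj) //.
have Np := sphere_projP oU sf t0t0 ft0 ff f_inj v Ux.
have r0 : r x != 0 by rewrite gt_eqF ?expR_gt0.
apply/eqP; rewrite -subr_eq0 opprK; apply/eqP.
apply: (sphere_normal_nondeg t0t0 (f := f) (x := x)).
  have /sphere_normalP[vt vf vT] := NvS; have /sphere_normalP[pt pf pT] := Np.
  by apply/sphere_normalP; split=> [||X']; rewrite lformDl lformZl ?vt ?pt ?vf ?pf ?vT ?pT mulr0 addr0.
move=> w Nw; rewrite lformDl lformZl lform_sphere_proj //.
have := Xv w (sphere_normal_lift Ux Nw); rewrite shape_lift_sphere // -scalemxAr XvS //.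
rewrite scalerA => /eqP; rewrite -subr_eq0 -scalerBl scaler_eq0 (negPf X0) orbF.
rewrite subr_eq0 => /eqP E; rewrite [lform v w]lformC -E [lform vS w]lformC.
by field.
Qed.

Lemma sphere_normal_euclid x w : Nf x w -> Ne x w.
Proof. by move=> /sphere_normalP[wt _ wT]; apply/euclid_normalP. Qed.

(** The curvature normal in the Euclidean space has the additional component
    [- f x], since the position vector has shape operator [- Id]. *)
Lemma sphere_euclid_curvature_normal (x X : 'rV[R]_n) vS vR : U x -> X != 0 -> Nf x vS -> Ne x vR ->
  (forall w, Nf x w -> X *m shape_mx f x w = lform w vS *: X) ->
  (forall w, Ne x w -> X *m shape_mx f x w = lform w vR *: X) ->
  vS = vR + f x.
Proof.
move=> Ux X0 NvS NvR XvS XvR.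
have /euclid_normalP[vRt vRT] := NvR; have /sphere_normalP[vSt vSf vST] := NvS.
have Nef : Ne x (f x).
  by apply/euclid_normalP; split=> [|Y]; [exact: ft0 | rewrite lformC f_f].
have shf : shape_mx f x (f x) = - 1%:M.
  apply/esym/(shape_mx_eq oU sf f_pos Ux) => Y Z.
  rewrite mulmxN mulmx1 (tangentN sf) // lformNl /hess.
  rewrite (dd_orth oU Y sf (smooth_on_dd Z sf) Ux) ?opprK // => y Uy.
  by rewrite lformC f_f.
have vRf : lform (f x) vR = -1.
  have := XvR _ Nef; rewrite shf mulmxN mulmx1 -scaleN1r => /eqP.
  by rewrite -subr_eq0 -scalerBl scaler_eq0 (negPf X0) orbF subr_eq0 => /eqP.
apply/eqP; rewrite -subr_eq0; apply/eqP.
apply: (sphere_normal_nondeg t0t0 (f := f) (x := x)).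
  apply/sphere_normalP; split=> [||Y]; rewrite lformBl lformDl.
  - by rewrite vSt vRt ft0 // addr0 subrr.
  - by rewrite vSf [lform vR _]lformC vRf ff // addNr subrr.
  - by rewrite vST vRT [lform (f x) _]lformC f_f // addr0 subrr.
move=> w Nw; have /sphere_normalP[_ wf _] := Nw.
rewrite lformBl lformDl [lform (f x) w]lformC wf addr0 !(lformC _ w).
have /eqP := etrans (esym (XvS w Nw)) (XvR w (sphere_normal_euclid Nw)).
by rewrite -subr_eq0 -scalerBl scaler_eq0 (negPf X0) orbF => /eqP.
Qed.

(** A common eigenvector of the shape operators of [f] has a curvature normal. *)
Lemma sphere_eigenvector_normal (x X : 'rV[R]_n) : U x -> X != 0 ->
  shape_eigenvector (T_sphere t0) f x X ->
  exists2 v, Nf x v & forall w, Nf x w -> X *m shape_mx f x w = lform w v *: X.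
Proof.
move=> Ux X0 ev; have q0 : lform (dd f x X) (dd f x X) != 0 by rewrite gt_eqF ?f_pos.
set q := lform _ _ in q0.
have Np := sphere_projP oU sf t0t0 ft0 ff f_inj (hess f x X X) Ux.
exists (q^-1 *: sphere_proj t0 f x (hess f x X X)).
  have /sphere_normalP[pt pf pT] := Np.
  by apply/sphere_normalP; split=> [||Y]; rewrite lformZl ?pt ?pf ?pT mulr0.
move=> w Nw; have [l Xl] := ev w Nw; rewrite Xl; congr (_ *: _).
rewrite lformZr lformC lform_sphere_proj // lformC -(shape_mxE oU sf f_pos) // Xl.
by rewrite (tangentZ sf) // lformZl -/q mulrC mulfK.
Qed.

(** The flat normal bundle provides a basis of common eigenvectors. *)
Lemma sphere_eigenbasis x : U x -> flat_normal_conn (T_sphere t0) U f ->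
  exists2 P : 'M[R]_n, P \in unitmx &
    forall i, shape_eigenvector (T_sphere t0) f x (row i P).
Proof.
move=> Ux flatN.
pose p k := sphere_proj t0 f x (delta_mx 0 k : 'rV[R]_N).
have Np k : Nf x (p k) by exact: (sphere_projP oU sf t0t0 ft0 ff f_inj).
pose As := [seq shape_mx f x (p k) | k <- enum 'I_N].
have [||| P uP dP] := @commuting_selfadjoint_eigenbasis R n (gram f x) As.
- by move=> X X0; rewrite -(gramE sf) // f_pos.
- move=> _ /mapP[k _ ->]; rewrite -[in RHS](gram_tr f x) -trmx_mul.
  rewrite /shape_mx -mulmxA mulVmx ?mulmx1; last exact: (gram_unit sf f_pos).
  by apply/matrixP => i j; rewrite !mxE (hessC oU sf).
- by move=> _ _ /mapP[k _ ->] /mapP[l _ ->]; apply: (ricci oU sf t0t0 ft0 ff f_inj).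
exists P => // i w Nw.
(* The projections [p k] of the standard basis span the normal space. *)
have wE : w = \sum_k w 0 k *: p k.
  apply/eqP; rewrite -subr_eq0; apply/eqP.
  apply: (sphere_normal_nondeg t0t0 (f := f) (x := x)).
    have /sphere_normalP[wt wf wT] := Nw.
    apply/sphere_normalP; split=> [||Y]; rewrite lformBl lform_suml ?wt ?wf ?wT big1 ?subrr // => k _;
      by have /sphere_normalP[pt pf pT] := Np k; rewrite lformZl ?pt ?pf ?pT mulr0.
  move=> w' Nw'; rewrite lformBl lform_suml {1}(row_sum_delta w) lform_suml.
  apply/eqP; rewrite subr_eq0; apply/eqP; apply: eq_bigr => k _.
  by rewrite !lformZl lform_sphere_proj.
have /fin_all_exists[d dE] : forall k, exists l, row i P *m shape_mx f x (p k) = l *: row i P.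
  move=> k; have [|d /(_ i) E] := dP (shape_mx f x (p k)); last by exists (d 0 i).
  by apply: map_f; rewrite mem_enum.
exists (\sum_k w 0 k * d k); rewrite {1}wE shape_mx_sum mulmx_sumr scaler_suml.
by apply: eq_bigr => k _; rewrite shape_mxZ -scalemxAr dE scalerA.
Qed.

(** If two curvature normals of [f] agreed, the space of shape operators of the
    lift would consist of operators with two equal eigenvalues. *)
Lemma lift_nondegenerate_uniform x (S : {vspace 'M[R]_n}) : U x ->
  flat_normal_conn (T_sphere t0) U f ->
  is_shape_space (@T_lorentz R N) U F x S -> \dim S = n ->
  exists v : 'I_n -> 'rV[R]_N, injective v /\
    forall i, exists E, is_curvature_normal (T_sphere t0) U f x E (v i).
Proof.
move=> Ux flatN SP dimS; have [P uP ev] := sphere_eigenbasis Ux flatN.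
have row0 i : row i P != 0.
  apply/eqP => ri0; have /(congr1 (row i)) := mulmxV uP.
  rewrite row_mul ri0 mul0mx => /rowP/(_ i); rewrite !mxE eqxx => /esym/eqP.
  by rewrite oner_eq0.
have /fin_all_exists2[v Nv vE] i := sphere_eigenvector_normal Ux (row0 i) (ev i).
exists v; split; last first.
  move=> i; eexists.
  exact: (is_curvature_normal_of (fun v A => sphere_shape_mxP v A Ux) (Nv i) (row0 i) (vE i)).
move=> i j vij; apply/eqP/negPn/negP => ij.
have : (\dim S < n)%N; last by rewrite dimS ltnn.
apply: (dim_equal_eigenvalues uP ij) => A /SP[w /(lift_shapeP _ _ Ux)[Nw ->]].
pose d k := lform w (sff F x (row k P) (row k P)) / lform (dd F x (row k P)) (dd F x (row k P)).
have dE k : row k P *m shape_mx F x w = d k *: row k P.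
  exact: (sphere_eigenvector_lift Ux (row0 k) (ev k) Nw).
exists d => //.
(* The sum of the two rows is an eigenvector as well. *)
have ij0 : row i P + row j P != 0.
  apply/eqP => s0; have : (delta_mx 0 i + delta_mx 0 j : 'rV[R]_n) *m P = 0.
    by rewrite mulmxDl -!rowE.
  move=> /(congr1 (mulmx^~ (invmx P))); rewrite mulmxK // mul0mx => /rowP/(_ i).
  by rewrite !mxE !eqxx (negPf ij) addr0 => /eqP; rewrite oner_eq0.
have evij : shape_eigenvector (T_sphere t0) f x (row i P + row j P).
  by move=> w' Nw'; exists (lform w' (v i)); rewrite mulmxDl !vE // -vij scalerDr.
have := sphere_eigenvector_lift Ux ij0 evij Nw; set m := _ / _.
rewrite mulmxDl !dE scalerDr => E.
have : ((d i - m) *: delta_mx 0 i + (d j - m) *: delta_mx 0 j : 'rV[R]_n) *m P = 0.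
  by rewrite mulmxDl -!scalemxAl -!rowE !scalerBl addrACA E -opprD subrr.
move=> /(congr1 (mulmx^~ (invmx P))); rewrite mulmxK // mul0mx => /rowP Z.
have := Z i; have := Z j; rewrite !mxE !eqxx [j == i]eq_sym (negPf ij) /=.
by move=> E1 E2; lra.
Qed.

(** Distinct curvature normals of [f] make the lift non-degenerate: by the
    Gauss equation the curvature normals of the lift are mutually orthogonal,
    and at most one of them is null. *)
Lemma lift_uniform_nondegenerate x (v : 'I_n -> 'rV[R]_N) : U x -> injective v ->
  (forall i, exists E, is_curvature_normal (T_sphere t0) U f x E (v i)) ->
  exists S : {vspace 'M[R]_n},
    is_shape_space (@T_lorentz R N) U F x S /\ \dim S = n.
Proof.
move=> Ux v_inj vE.
have Nv i : Nf x (v i).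
  by have [E /(curvature_normalP (fun v A => sphere_shape_mxP v A Ux))[]] := vE i.
have /fin_all_exists2[X X0 Xv] i : exists2 X : 'rV[R]_n, X != 0 &
    forall w, Nf x w -> X *m shape_mx f x w = lform w (v i) *: X.
  have [E /(curvature_normalP (fun v A => sphere_shape_mxP v A Ux))[_ [X EX X0] XE]] := vE i.
  by exists X => // w; exact: XE.
have ev i : shape_eigenvector (T_sphere t0) f x (X i) by move=> w /(Xv i) E; eexists; exact: E.
have vv i j : i != j -> lform (v i - v j) (v i - v j) != 0.
  move=> ij; rewrite gt_eqF // (lform_spacelike t0t0) //.
    by have /sphere_normalP[] := sphere_normalB (Nv i) (Nv j).
  by rewrite subr_eq0; apply: contra ij => /eqP/v_inj ->.
have orth i j : i != j -> lform (dd f x (X i)) (dd f x (X j)) = 0.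
  move=> ij; have Nw := sphere_normalB (Nv i) (Nv j).
  have E1 := shape_mxE oU sf f_pos (v i - v j) (X i) (X j) Ux.
  have E2 := shape_mxE oU sf f_pos (v i - v j) (X j) (X i) Ux.
  rewrite Xv // (tangentZ sf) // lformZl in E1; rewrite Xv // (tangentZ sf) // lformZl in E2.
  rewrite (hessC oU sf) // -E2 [lform (dd f x (X j)) _]lformC in E1.
  apply/eqP; move/eqP: E1; rewrite -subr_eq0 -mulrBl -lformBr mulf_eq0.
  by rewrite (negPf (vv i j ij)).
have q0 i : lform (dd F x (X i)) (dd F x (X i)) != 0 by rewrite gt_eqF ?F_pos.
pose V i := (lform (dd F x (X i)) (dd F x (X i)))^-1 *: sff F x (X i) (X i).
have NFZ a w : NF x w -> NF x (a *: w).
  by move=> /lift_normalP Nw; apply/lift_normalP => Y; rewrite lformZl Nw mulr0.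
have NFD w w' : NF x w -> NF x w' -> NF x (w + w').
  by move=> /lift_normalP Nw /lift_normalP Nw'; apply/lift_normalP => Y; rewrite lformDl Nw Nw' addr0.
have NV i : NF x (V i) by apply/NFZ/sff_lift_normal.
have XV i w : NF x w -> X i *m shape_mx F x w = lform w (V i) *: X i.
  by move=> Nw; rewrite (sphere_eigenvector_lift Ux (X0 i) (ev i) Nw) lformZr mulrC.
have VV i j : i != j -> lform (V i) (V j) = 0.
  move=> ij; rewrite lformZl lformZr lift_gauss // (sff_lift_conjugate Ux (ev j)).
    by rewrite lform0l !mulr0.
  by rewrite orth // eq_sym.
have FV i : lform (F x) (V i) = -1 by apply: (lift_curvature_normal Ux (X0 i)) => w; exact: XV.
have wV w i : Nf x w -> lform w (V i) = - (r x)^-1 * lform w (v i).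
  move=> Nw; have := XV i w (sphere_normal_lift Ux Nw).
  rewrite shape_lift_sphere // -scalemxAr Xv // scalerA => /eqP.
  by rewrite eq_sym -subr_eq0 -scalerBl scaler_eq0 (negPf (X0 i)) orbF subr_eq0 => /eqP.
(* Two null curvature normals would differ by a multiple of [f x + t0]. *)
have null_uniq i j : lform (V i) (V i) = 0 -> lform (V j) (V j) = 0 -> i = j.
  move=> ii jj; apply/eqP/negPn/negP => ij; set w := v i - v j.
  have Nw : Nf x w by exact: sphere_normalB.
  have zF : lform (V i - V j) (F x) = 0 by rewrite lformBl !(lformC _ (F x)) !FV subrr.
  have zz : lform (V i - V j) (V i - V j) = 0.
    by rewrite lformBl !lformBr ii jj VV // [lform (V j) _]VV 1?eq_sym // !subrr.
  have zE := null_orth Ux (lift_null_orth Ux zF) zz.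
  have /sphere_normalP[wt wf _] := Nw.
  have : lform w (V i - V j) = 0 by rewrite zE lformZr lformDr wt wf addr0 mulr0.
  rewrite lformBr !wV // -mulrBr -lformBr => /eqP; rewrite mulf_eq0 (negPf (vv i j ij)) orbF.
  by rewrite oppr_eq0 invr_eq0 gt_eqF ?expR_gt0.
pose P : 'M[R]_n := \matrix_i X i.
have rP i : row i P = X i by rewrite rowK.
have uP : P \in unitmx.
  rewrite -row_free_unit -kermx_eq0; apply/negP => /negP /rowV0Pn[c /sub_kermxP cP] /negP; apply.
  apply/eqP/rowP => j; rewrite mxE.
  have : lform (dd f x (c *m P)) (dd f x (X j)) = 0 by rewrite cP (tangent0 sf) // lform0l.
  have -> : dd f x (c *m P) = \sum_i c 0 i *: dd f x (X i).
    rewrite mulmx_sum_row; elim: (index_enum 'I_n) => [|i s IHs].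
      by rewrite !big_nil (tangent0 sf).
    by rewrite !big_cons (tangentD sf) // (tangentZ sf) // IHs rP.
  rewrite lform_suml (bigD1 j) //= big1 => [|i ij]; last by rewrite lformZl orth // mulr0.
  rewrite lformZl addr0 => /eqP; rewrite mulf_eq0 => /orP[/eqP//|].
  by rewrite gt_eqF // f_pos.
(* The projections onto the principal lines are shape operators: [V k] gives
   the [k]-th one when it is not null; a null one is what remains of the
   identity. *)
pose a k := (lform (V k) (V k))^-1.
pose w k := if lform (V k) (V k) == 0 then - F x - \sum_(j | j != k) a j *: V j
            else a k *: V k.
have Nsum k : NF x (\sum_(j | j != k) a j *: V j).
  apply/lift_normalP => Y; rewrite lform_suml big1 // => j _.
  by rewrite lformZl; have /lift_normalP -> := NV j; rewrite mulr0.
have Nw k : NF x (w k).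
  rewrite /w; case: ifP => _; last exact: NFZ.
  rewrite -opprD -scaleN1r; apply/NFZ/NFD => //; exact: lift_normal_self.
have wE k i : lform (w k) (V i) = (i == k)%:R.
  rewrite /w; case: ifPn => [kk|kk]; last first.
    rewrite lformZl; have [->|ik] := eqVneq i k; first by rewrite /a mulVf.
    by rewrite VV ?mulr0 // eq_sym.
  rewrite lformBl lformNl FV opprK lform_suml; have [->|ik] := eqVneq i k.
    by rewrite big1 ?subr0 // => j jk; rewrite lformZl VV ?mulr0.
  rewrite (bigD1 i) //= big1 => [|j /andP[_ ji]]; last by rewrite lformZl VV ?mulr0.
  rewrite addr0 lformZl /a mulVf ?subrr //; apply: contra ik => ii.
  by apply/eqP/null_uniq; apply/eqP.
have shw k : shape_mx F x (w k) = row_proj P k.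
  by apply: (eq_on_rows uP) => i; rewrite row_projE // rP XV // wE.
exists (row_proj_space P); split; last exact: dim_row_proj_space.
move=> A; rewrite row_proj_spaceP; split=> [[d ->]|[y /(lift_shapeP _ _ Ux)[Ny ->]]].
  exists (\sum_k d k *: w k); apply/(lift_shapeP _ _ Ux); split.
    apply/lift_normalP => Y; rewrite lform_suml big1 // => j _.
    by rewrite lformZl; have /lift_normalP -> := Nw j; rewrite mulr0.
  by rewrite shape_mx_sum; apply: eq_bigr => k _; rewrite shape_mxZ shw.
exists (fun k => lform y (V k)); apply: (row_proj_sum uP) => i.
by rewrite rP XV.
Qed.

End Lift.

Unset Implicit Arguments.

Theorem theorem2p8 (R : realType) (n : nat) (n_ge3 : (2 < n)%N)
  (M : manifold R n) (t0 : 'rV[R]_(2 * n)) (t0_timelike : lform t0 t0 = -1)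
  (f F : M -> 'rV[R]_(2 * n)) (u : M -> R)
  (f_immersion : immersion f)
  (f_sphere : forall p, unit_sphere t0 (f p))
  (f_conformally_flat : conformally_flat f)
  (f_flat_normal : flat_normal_bundle (T_sphere t0) f)
  (F_flat_lift : flat_lift t0 f u F) :
  [/\ (* 1 *)
      forall c p, chart_at c p -> forall X : 'rV[R]_n,
        curvature_direction (@T_lorentz R (2 * n)) F c p X <->
        curvature_direction (T_sphere t0) f c p X,
      (* 2 *)
      forall c p, chart_at c p ->
        forall (X : 'rV[R]_n) (k : R) (e et : 'rV[R]_(2 * n))
          (E ES ER : set 'rV[R]_n) (v vS vR : 'rV[R]_(2 * n)),
        (* the unit vectors e and et span the same direction of M *)
        e = dmap F c p X -> lform e e = 1 ->
        0 < k -> et = dmap f c p (k *: X) -> lform et et = 1 ->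
        E X -> curvature_normal (@T_lorentz R (2 * n)) F c p E v ->
        ES X -> curvature_normal (T_sphere t0) f c p ES vS ->
        ER X -> curvature_normal (T_euclid t0) f c p ER vR ->
        [/\ et = - e + (expR (- u p) * lform e t0) *: F p,
            vS = - (expR (u p) *:
                    oproj (normal_subspace (T_sphere t0) (loc f c) (cmap c p)) v)
          & vS = vR + f p],
      (* 3 *)
      forall c p, chart_at c p -> forall E v,
        curvature_normal (@T_lorentz R (2 * n)) F c p E v -> v != 0
    & (* 4 *)
      nondegenerate_normal_bundle (@T_lorentz R (2 * n)) F <->
      uniform_multiplicity_one (T_sphere t0) f].
Proof.
have [f_smooth f_inj] := f_immersion; have [[u_smooth flat] FE] := F_flat_lift.
have oU (c : chart R n M) : atlas c -> open (ccod c) by move=> /atlas_charts[].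
have sf c : atlas c -> smooth_on (ccod c) (loc f c) by exact: f_smooth.
have su c : atlas c -> smooth_on (ccod c) (u \o cinv c : _ -> R^o) by exact: u_smooth.
have ft0 c x : ccod c x -> lform (loc f c x) t0 = 0 by have [] := f_sphere (cinv c x).
have ff c x : ccod c x -> lform (loc f c x) (loc f c x) = 1.
  by have [] := f_sphere (cinv c x).
have inj c : atlas c -> forall x, ccod c x -> forall X, dd (loc f c) x X = 0 -> X = 0.
  by move=> ac _ [p cp <-] X; rewrite -ddE; apply: f_inj.
have FE' c x : ccod c x ->
    loc F c x = - (expR ((u \o cinv c) x) *: (loc f c x + t0)) by move=> _; exact: FE.
have inU (c : chart R n M) p : chart_at c p -> ccod c (cmap c p) by case=> _ cp; exists p.
have cK (c : chart R n M) p : chart_at c p -> cinv c (cmap c p) = p.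
  by case=> /atlas_charts[_ _ + _ _] cp; apply.
split.
- move=> c p cp X; have [ac _] := cp; rewrite /curvature_direction.
  exact: (lift_curvature_direction n_ge3 (oU c ac) (sf c ac) t0_timelike (ft0 c) (ff c)
    (inj c ac) (su c ac) (FE' c) (flat c ac) X (inU c p cp)).
- move=> c p cp X k e et E ES ER v vS vR eE ee k0 etE etet EX Ev ESX ESv ERX ERv.
  have [ac _] := cp; have Ux := inU c p cp.
  have X0 : X != 0.
    apply/eqP => X0; move: ee; rewrite eE X0 /dmap derive0 lform0l => /eqP.
    by rewrite eq_sym oner_eq0.
  have [Nv _ XE] := curvature_normalP (fun v A => lift_shapeP (oU c ac) (sf c ac) t0_timelike
    (ft0 c) (ff c) (inj c ac) (su c ac) (FE' c) v A Ux) Ev.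
  have [NvS _ XES] := curvature_normalP (fun v A => sphere_shape_mxP (oU c ac) (sf c ac)
    t0_timelike (ft0 c) (ff c) (inj c ac) v A Ux) ESv.
  have [NvR _ XER] := curvature_normalP (fun v A => euclid_shapeP (oU c ac) (sf c ac)
    t0_timelike (ft0 c) (inj c ac) v A Ux) ERv.
  have XvS w := XES X w ESX.
  have Fp : loc F c (cmap c p) = F p by rewrite /loc /= cK.
  have fp : loc f c (cmap c p) = f p by rewrite /loc /= cK.
  have up : (u \o cinv c) (cmap c p) = u p by rewrite /= cK.
  split.
  + rewrite -Fp -up; move: eE etE; rewrite /dmap !ddE => eE etE.
    exact: (unit_tangent_lift (oU c ac) (sf c ac) t0_timelike (ft0 c) (ff c)
      (su c ac) (FE' c) Ux eE ee k0 etE etet).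
  + rewrite -up; apply: (lift_sphere_curvature_normal (oU c ac) (sf c ac) t0_timelike (ft0 c)
      (ff c) (inj c ac) (su c ac) (FE' c) Ux X0 NvS _ XvS) => w.
    exact: XE.
  + rewrite -fp; apply: (sphere_euclid_curvature_normal (oU c ac) (sf c ac) t0_timelike (ft0 c)
      (ff c) (inj c ac) Ux X0 NvS NvR XvS) => w.
    exact: XER.
- move=> c p cp E v; have [ac _] := cp.
  exact: (lift_curvature_normal_neq0 (oU c ac) (sf c ac) t0_timelike (ft0 c) (ff c)
    (inj c ac) (su c ac) (FE' c) (inU c p cp)).
- split=> [nd|[_ um] c p cp].
    split=> // c p cp; have [ac _] := cp; have [S [SP dimS]] := nd c p cp.
    exact: (lift_nondegenerate_uniform n_ge3 (oU c ac) (sf c ac) t0_timelike (ft0 c) (ff c)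
      (inj c ac) (su c ac) (FE' c) (flat c ac) (inU c p cp) (f_flat_normal c ac) SP dimS).
  have [ac _] := cp; have [v [v_inj vE]] := um c p cp.
  exact: (lift_uniform_nondegenerate n_ge3 (oU c ac) (sf c ac) t0_timelike (ft0 c) (ff c)
    (inj c ac) (su c ac) (FE' c) (flat c ac) (inU c p cp) v_inj vE).
Qed.
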